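(* Let $\mathcal{D}$ be a weighted rooted graph on the vertices $\{x_1,\ldots,x_n\}$ with root vertex $x_1$, and let $R=k[x_1,\ldots,x_n]$. Suppose $w_i\geq 2$ for all $i\neq 1$. Then $$\operatorname{pdim}(R/I(\mathcal{D}))=n-1 \quad\text{and}\quad \operatorname{reg}(R/I(\mathcal{D}))=\sum_{i=1}^n w_i-n+1.$$
   Context: An oriented graph $\mathcal{D}=(V(\mathcal{D}),E(\mathcal{D}))$ is a finite simple graph (no loops, no multiple edges) in which each edge is given exactly one orientation; $(x,y)\in E(\mathcal{D})$ denotes an edge oriented from $x$ to $y$. It is weighted if it comes with a function $w:V(\mathcal{D})\to\mathbb{N}^+$; write $w_i=w(x_i)$. A source vertex is a vertex having only outgoing edges; by convention source vertices have weight $1$. With $k$ a field and $R=k[x_1,\ldots,x_n]$, the edge ideal of $\mathcal{D}$ is $I(\mathcal{D})=(x_ix_j^{w_j} : (x_i,x_j)\in E(\mathcal{D}))\subseteq R$. A weighted oriented graph $\mathcal{D}$ is called rooted if there is a vertex distinguished as the root and there is a naturally oriented path (i.e., all edges on the path are in the same direction) from the root to any other vertex of $\mathcal{D}$; the orientation of $\mathcal{D}$ is determined by naturally oriented paths from the root to other vertices. The only source vertex of a weighted rooted graph is its root (so the root has weight $1$). $\operatorname{pdim}$ is projective dimension over $R$ and $\operatorname{reg}(R/I)=\max\{j-i : \beta_{i,j}(R/I)\neq 0\}$ is Castelnuovo–Mumford regularity.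
   Formalization: n ≥ 2 is assumed: for a single vertex I(D)=0 and reg(R/I(D))=0, while the formula gives 1. ''Orientation determined by naturally oriented paths from the root'' is read as: each edge points the way root paths meet its ends, so there are no directed cycles. *)

(* Defs.v *)
From HB Require Import structures.
From mathcomp Require Import all_boot all_order all_algebra.
From mathcomp Require Import generic_quotient ring_quotient.
From mathcomp Require Import boolp.
From mathcomp Require Export mpoly.

Set Implicit Arguments.
Unset Strict Implicit.
Unset Printing Implicit Defensive.

Import GRing.Theory.
Local Open Scope ring_scope.
Local Open Scope quotient_scope.

(** * Weighted oriented graphs *)

Record wograph (n : nat) := WOGraph {
  edge : rel 'I_n;
  weight : 'I_n -> nat;
  edge_irr : irreflexive edge;
  edge_asym : forall x y, edge x y -> ~~ edge y x;
  weight_gt0 : forall x, (0 < weight x)%N;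
  weight_source : forall x, (forall y, ~~ edge y x) -> weight x = 1%N
}.

Definition source n (D : wograph n) (x : 'I_n) : Prop :=
  forall y, ~~ edge D y x.

Definition adjacent n (D : wograph n) (x y : 'I_n) : bool :=
  edge D x y || edge D y x.

(* The vertices x :: p, without repetition, form a naturally oriented path. *)
Definition oriented_path n (D : wograph n) (x : 'I_n) (p : seq 'I_n) : bool :=
  path (edge D) x p && uniq (x :: p).

(* [rooted_orientation] says that the orientation is determined by the
   naturally oriented paths from the root: an edge {x, y} is oriented from x
   to y exactly when some such path meets x before y.  It excludes directed
   cycles and edges entering the root (see [rooted_sourceP]). *)
Record rooted n (D : wograph n) (r : 'I_n) : Prop := Rooted {
  rooted_path : forall v, exists2 p, oriented_path D r p & last r p = v;
  rooted_orientation : forall x y, adjacent D x y ->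
    (edge D x y <-> exists2 p, oriented_path D r p & mem2 (r :: p) x y)
}.

Lemma rooted_sourceP n (D : wograph n) (r : 'I_n) :
  rooted D r -> forall x, source D x <-> x = r.
Proof.
move=> rD x; split=> [srcx | ->].
  have [p /andP[pp _] px] := rooted_path rD x.
  case/lastP: p pp px => [_ <- //| q u].
  rewrite rcons_path last_rcons => /andP[_ e] ux.
  by move: (srcx (last r q)); rewrite -ux e.
move=> y; apply/negP=> eyr.
have adj : adjacent D r y by rewrite /adjacent eyr orbT.
have [p pp py] := rooted_path rD y.
suff ery : edge D r y by move: (edge_asym ery); rewrite eyr.
apply/(rooted_orientation rD adj); exists p => //.
by rewrite /mem2 /= eqxx -py mem_last.
Qed.

Lemma rooted_weight n (D : wograph n) (r : 'I_n) :
  rooted D r -> weight D r = 1%N.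
Proof. by move=> rD; apply: weight_source; apply/(rooted_sourceP rD). Qed.

(** * Cyclic modules R / I *)

Section IdealQuotient.

Variables (R : comNzRingType) (J : finType) (P : pred J) (g : J -> R).

(* The ideal generated by the g j such that P j. *)
Definition ideal : {pred R} :=
  fun f => `[< exists c : J -> R, f = \sum_(j | P j) c j * g j >].

Lemma idealE f :
  (f \in ideal) <-> exists c : J -> R, f = \sum_(j | P j) c j * g j.
Proof. by split=> /asboolP. Qed.

Lemma ideal_zmod_closed : zmod_closed ideal.
Proof.
split; first by apply/idealE; exists (fun=> 0); rewrite big1 // => j _; rewrite mul0r.
move=> _ _ /idealE[c ->] /idealE[d ->]; apply/idealE.
exists (fun j => c j - d j); rewrite -sumrB.
by apply: eq_bigr => j _; rewrite mulrBl.
Qed.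

HB.instance Definition _ := GRing.isZmodClosed.Build R ideal ideal_zmod_closed.

Lemma ideal_mull a f : f \in ideal -> a * f \in ideal.
Proof.
case/idealE=> c ->; apply/idealE; exists (fun j => a * c j).
by rewrite mulr_sumr; apply: eq_bigr => j _; rewrite mulrA.
Qed.

(* The quotient Z-module, made an R-module by a *: \pi b = \pi (a * b). *)
Definition quotmod : Type := Quotient.quot ideal.

HB.instance Definition _ := GRing.Zmodule.on quotmod.

Definition pimod (f : R) : quotmod := \pi_(Quotient.quot ideal) f.

Lemma pimod_eq f h : pimod f = pimod h <-> f - h \in ideal.
Proof. by rewrite /pimod Quotient.idealrBE; split=> [->|/eqP]. Qed.

Lemma pimod_surj (x : quotmod) : exists f, pimod f = x.
Proof. by exists (repr (x : Quotient.quot ideal)); rewrite /pimod reprK. Qed.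

Lemma pimodD f h : pimod (f + h) = pimod f + pimod h.
Proof. exact: (raddfD (\pi_(Quotient.quot ideal))). Qed.

Definition quotmod_scale (a : R) (x : quotmod) : quotmod :=
  pimod (a * repr (x : Quotient.quot ideal)).

Lemma quotmod_scaleE a f : quotmod_scale a (pimod f) = pimod (a * f).
Proof.
apply/pimod_eq; rewrite -mulrBr ideal_mull //.
by apply/pimod_eq; rewrite /pimod reprK.
Qed.

Lemma quotmod_scaleA a b x :
  quotmod_scale a (quotmod_scale b x) = quotmod_scale (a * b) x.
Proof. by case: (pimod_surj x) => f <-; rewrite !quotmod_scaleE mulrA. Qed.

Lemma quotmod_scale1 : left_id 1 quotmod_scale.
Proof. by move=> x; case: (pimod_surj x) => f <-; rewrite quotmod_scaleE mul1r. Qed.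

Lemma quotmod_scaleDr : right_distributive quotmod_scale +%R.
Proof.
move=> a x y; case: (pimod_surj x) (pimod_surj y) => f <- [h <-].
by rewrite -pimodD !quotmod_scaleE mulrDr pimodD.
Qed.

Lemma quotmod_scaleDl x : {morph quotmod_scale^~ x : a b / a + b}.
Proof.
move=> a b; case: (pimod_surj x) => f <-.
by rewrite !quotmod_scaleE mulrDl pimodD.
Qed.

HB.instance Definition _ := GRing.Zmodule_isLmodule.Build R quotmod
  quotmod_scaleA quotmod_scale1 quotmod_scaleDr quotmod_scaleDl.

End IdealQuotient.

(** * Resolutions and projective dimension *)

Definition projective (R : nzRingType) (P : lmodType R) : Prop :=
  forall (M N : lmodType R) (g : {linear M -> N}) (f : {linear P -> N}),
    (forall y, exists x, g x = y) ->
    exists h : {linear P -> M}, forall x, g (h x) = f x.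

(* Exactness of ... -> F 2 -> F 1 -> F 0 -> M -> 0, with maps d i and eps. *)
Definition resolution (R : nzRingType) (M : lmodType R) (F : nat -> lmodType R)
    (d : forall i, {linear F i.+1 -> F i}) (eps : {linear F 0%N -> M}) : Prop :=
  [/\ forall y, exists x, eps x = y,
      forall x, eps x = 0 <-> exists y, d 0%N y = x &
      forall i x, d i x = 0 <-> exists y, d i.+1 y = x].

Definition has_projective_resolution (R : nzRingType) (M : lmodType R)
    (l : nat) : Prop :=
  exists (F : nat -> lmodType R) (d : forall i, {linear F i.+1 -> F i})
         (eps : {linear F 0%N -> M}),
    [/\ resolution d eps, forall i, projective (F i) &
        forall i, (l < i)%N -> forall x : F i, x = 0].

Definition is_pdim (R : nzRingType) (M : lmodType R) (l : nat) : Prop :=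
  has_projective_resolution M l /\
  forall l', has_projective_resolution M l' -> (l <= l')%N.

(** * Graded Betti numbers and regularity of k[x_1, ..., x_n] / I *)

Section Graded.

Variables (k : fieldType) (n : nat) (J : finType) (P : pred J).
Variable g : J -> {mpoly k[n]}.

Notation R := {mpoly k[n]}.
Notation M := (quotmod P g).

(* A minimal graded free resolution of R / I: F_i is the direct sum of the
   R(- e i c) for c < b i, realised as row vectors, the differential
   F_(i+1) -> F_i is right multiplication by phi i, and minimality means that
   the entries of phi i lie in the maximal ideal (x_1, ..., x_n).  Shifts are
   naturals since the generators of a minimal resolution of R / I have
   nonnegative degrees. *)
Definition minimal_graded_resolution (b : nat -> nat)
    (e : forall i, 'I_(b i) -> nat) (phi : forall i, 'M[R]_(b i.+1, b i))
    (eps : {linear 'rV[R]_(b 0%N) -> M}) : Prop :=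
  [/\ resolution (F := fun i => 'rV[R]_(b i)) (fun i => mulmxr (phi i)) eps,
      forall c, exists2 a : R, a \is (e 0%N c).-homog &
        eps (delta_mx 0 c) = pimod P g a,
      forall i r c,
        if (e i c <= e i.+1 r)%N
        then phi i r c \is (e i.+1 r - e i c)%N.-homog
        else phi i r c == 0 &
      forall i r c, (phi i r c)@_0%MM = 0].

(* beta_(i,j)(R / I) = m; relational, minimal graded free resolutions being
   unique up to isomorphism. *)
Definition is_betti (i j m : nat) : Prop :=
  exists b e phi eps,
    @minimal_graded_resolution b e phi eps /\ #|[set c | e i c == j]| = m.

(* r is the maximum of the j - i such that beta_(i,j)(R / I) != 0. *)
Definition is_regularity (r : int) : Prop :=
  (exists i j m, [/\ is_betti i j m, m != 0%N & j%:Z - i%:Z = r]) /\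
  (forall i j m, is_betti i j m -> m != 0%N -> j%:Z - i%:Z <= r).

End Graded.

(** * Edge ideals *)

Section EdgeIdeal.

Variables (k : fieldType) (n : nat) (D : wograph n).

Definition is_edge (p : 'I_n * 'I_n) : bool := edge D p.1 p.2.

Definition edge_gen (p : 'I_n * 'I_n) : {mpoly k[n]} :=
  'X_p.1 * 'X_p.2 ^+ weight D p.2.

(* The module R / I(D), where I(D) is [ideal is_edge edge_gen]. *)
Definition edge_quot : lmodType {mpoly k[n]} := quotmod is_edge edge_gen.

Definition edge_regularity (r : int) : Prop := is_regularity is_edge edge_gen r.

End EdgeIdeal.

(* Main.v *)
(* The edge ideal I(D) is handled through a graded free resolution of R / I(D) of
   length n - 1 all of whose generators in homological degree i have internal
   degree at most i + rho, rho = sum w_i - n + 1, with equality for some generator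
   in homological degree n - 1.  It is built by removing a sink v of the (acyclic)
   graph, with in-neighbours P: for f = x_v^w(v),
   I(D) : f = I(D - v - P) + (P)  and  I(D) + (f) = I(D - v) + (f),
   and f is regular modulo I(D - v), so a mapping cone followed by the horseshoe
   construction on 0 -> R/(I : f) -> R/I -> R/(I + f) -> 0 gives the resolution.
   Cancelling the unit entries makes it minimal; the extremal generator survives
   because its degree occurs in no adjacent homological degree.  Comparison maps
   and homotopies show that no projective resolution is shorter and that every
   minimal graded resolution has generators in the same degrees. *)
Require Import Defs.
From mathcomp Require Import all_boot all_order all_algebra.
From HB Require Import structures.
From mathcomp Require Import boolp zify.

Set Implicit Arguments.
Unset Strict Implicit.
Unset Printing Implicit Defensive.

Import GRing.Theory.
Local Open Scope ring_scope.

(** * Homogeneous parts and monomial ideals *)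

Section HomogeneousParts.

Variables (n : nat) (k : fieldType).
Implicit Types p q : {mpoly k[n]}.

(** The graph D - v - P need not be rooted, so on the colon side the sharp induction
    ([has_gres_rooted]) is fed by a crude one, valid for every induced subgraph ([has_gres_edges]):
    length at most |V|, and degrees bounded through the sum of max(1, w_i - 1). The loss is
    harmless. Off the root max(1, w_i - 1) = w_i - 1, since w_i >= 2; and if the root survives in D
    - v - P, its contribution 1 is paid for by some p in P, which is then not the root and would
    have contributed w_p - 1 >= 1. The extremal generator arises with a single edge, from the colon
    quotient R/(x_r). Afterwards it is inherited through R/(I + f), where the cone raises internal
    minus homological degree by w(v) - 1; adding these increments gives rho. *)

Lemma pihomog_sum d p : exists2 l, (d < l)%N & p = \sum_(i < l) pihomog mdeg i p.
Proof.
(* Padding with zero parts makes [d] a legal index of the sum. *)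
exists (maxn (mmeasure mdeg p) d.+1); first by rewrite leq_maxr.
by apply: pihomog_partitionE; rewrite leq_maxl.
Qed.

Lemma mcoeff_pihomog d p m : (pihomog mdeg d p)@_m = p@_m *+ (mdeg m == d).
Proof.
have [<-|ne] := eqVneq (mdeg m) d; last first.
  exact: dhomog_nemf_coeff (pihomogP _ _ _) ne.
have [l lt_l E] := pihomog_sum (mdeg m) p.
rewrite mulr1n [in RHS]E [RHS](raddf_sum (mcoeff m)).
rewrite [RHS](bigD1 (Ordinal lt_l)) //= big1 ?addr0 //.
move=> i ne; apply: (dhomog_nemf_coeff (pihomogP _ _ _)).
by rewrite eq_sym; apply: contra ne => /eqP e; apply/eqP/val_inj.
Qed.

Lemma pihomogMr d e p q :
  q \is e.-homog -> pihomog mdeg (d + e) (p * q) = pihomog mdeg d p * q.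
Proof.
move=> hq; have [l lt_l {1}->] := pihomog_sum d p.
rewrite mulr_suml raddf_sum (bigD1 (Ordinal lt_l)) //= big1 ?addr0 => [|i ne].
  by rewrite pihomog_dE //; apply: dhomogM (pihomogP _ _ _) hq.
apply: (pihomog_ne0 (d := (i + e)%N)); last exact: dhomogM (pihomogP _ _ _) hq.
by rewrite eqn_add2r; apply: contra ne => /eqP ?; apply/eqP/val_inj.
Qed.

Lemma pihomogM_lt d e p q :
  q \is e.-homog -> (d < e)%N -> pihomog mdeg d (p * q) = 0.
Proof.
move=> hq lt_de; have [l _ ->] := pihomog_sum d p.
rewrite mulr_suml raddf_sum big1 //= => i _.
apply: (pihomog_ne0 (d := (i + e)%N)); last exact: dhomogM (pihomogP _ _ _) hq.
by rewrite neq_ltn orbC (leq_trans lt_de) ?leq_addl.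
Qed.

Lemma homog0_const p : p \is 0.-homog -> p = (p@_0%MM)%:MP.
Proof.
move/dhomogP=> hp; apply/mpolyP=> m; rewrite mcoeffC.
have [->|nm] := eqVneq m 0%MM; first by rewrite mulr1.
rewrite mulr0; apply/eqP; rewrite mcoeff_eq0; apply/negP=> /hp /eqP.
by rewrite mdeg_eq0 (negPf nm).
Qed.

End HomogeneousParts.

Section MonomialIdeals.

Variables (n : nat) (k : fieldType).
Implicit Types (p q : {mpoly k[n]}) (U : pred 'X_{1..n}).

Definition up_closed U := forall m m', U m -> U (m + m')%MM.

(** A monomial ideal is carried by its set of exponents: the colon by ['X_[a]] becomes translation
    of [U] by [a], and adding ['X_[a]] becomes disjunction with [a <= m], so identities between
    ideals reduce to boolean ones. *)
Definition monideal U : {pred {mpoly k[n]}} := fun p => all U (msupp p).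

Lemma monidealP U p : reflect (forall m, p@_m != 0 -> U m) (p \in monideal U).
Proof. by apply: (iffP allP) => h m; have := h m; rewrite mcoeff_msupp. Qed.

Lemma eq_monideal U U' : U =1 U' -> monideal U =i monideal U'.
Proof. by move=> e p; apply: eq_all. Qed.

Lemma monideal_zmod_closed U : zmod_closed (monideal U).
Proof.
split=> [|p q /monidealP hp /monidealP hq].
  by apply/monidealP=> m; rewrite mcoeff0 eqxx.
apply/monidealP=> m; rewrite mcoeffB.
have [->|/hp//] := eqVneq p@_m 0; have [->|/hq//] := eqVneq q@_m 0.
by rewrite subr0 eqxx.
Qed.

HB.instance Definition _ U :=
  GRing.isZmodClosed.Build _ (monideal U) (monideal_zmod_closed U).

Lemma monidealMl U p q : up_closed U -> q \in monideal U -> p * q \in monideal U.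
Proof.
move=> upU /allP hq; apply/allP=> m /msuppM_le /allpairsP[[m1 m2] /= [_ h ->]].
by rewrite addmC; apply/upU/hq.
Qed.

Lemma monideal_pihomog U d p :
  p \in monideal U -> pihomog mdeg d p \in monideal U.
Proof.
move/monidealP=> hp; apply/monidealP=> m; rewrite mcoeff_pihomog.
by case: (mdeg m == d); [apply: hp | rewrite mulr0n eqxx].
Qed.

Lemma monidealMX U a p :
  (p * 'X_[a] \in monideal U) = (p \in monideal (fun m => U (m + a)%MM)).
Proof.
rewrite -[LHS]/(all U (msupp _)) (perm_all _ (msuppMX _ _)) all_map.
by apply: eq_all => m /=; rewrite addmC.
Qed.

(* Splits off the monomials divisible by ['X_[a]]. *)
Lemma monideal_addX U a p :
  p \in monideal (fun m => U m || (a <= m)%MM) ->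
  exists q, p - q * 'X_[a] \in monideal U.
Proof.
move/allP=> hp; exists (\sum_(m <- msupp p | (a <= m)%MM) p@_m *: 'X_[m - a]).
rewrite {1}[p]mpolyE (bigID (fun m => (a <= m)%MM)) /= mulr_suml addrAC -sumrB.
rewrite big1 ?add0r => [|m le_am]; last first.
  by rewrite -scalerAl -mpolyXD submK // subrr.
rewrite big_seq_cond; apply: rpred_sum => m /andP[/hp /orP[Um _|->//]].
apply/monidealP=> m'; rewrite mcoeffZ mcoeffX.
by have [<-|_] := eqVneq m m'; rewrite // mulr0 eqxx.
Qed.

End MonomialIdeals.

(** * Graded matrices *)

Section GradedMatrices.

Variables (n : nat) (k : fieldType).
Notation R := {mpoly k[n]}.

Definition bipart (h e h' e' : nat) (x : R) : R :=
  if (h == h') && (e' <= e)%N then pihomog mdeg (e - e') x else 0.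

Lemma bipart_zmod h e h' e' : additive (bipart h e h' e').
Proof.
by move=> x y; rewrite /bipart; case: ifP => _; rewrite ?raddfB ?subr0.
Qed.

HB.instance Definition _ h e h' e' :=
  GRing.isAdditive.Build R R (bipart h e h' e') (@bipart_zmod h e h' e').

Lemma bipartP h e h' e' x : bipart h e h' e' x = x <->
  (x != 0 -> [/\ h = h', (e' <= e)%N & x \is (e - e').-homog]).
Proof.
rewrite /bipart; split=> [<-|hx].
  by case: ifP => [/andP[/eqP-> ->] _|_]; [split=> //; apply: pihomogP | rewrite eqxx].
have [->|nx] := eqVneq x 0; first by case: ifP => //; rewrite raddf0.
by have [-> -> hom] := hx nx; rewrite eqxx pihomog_dE.
Qed.

Lemma bipartMr h e h' e' h'' e'' x b : bipart h' e' h'' e'' b = b ->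
  bipart h e h'' e'' (x * b) = bipart h e h' e' x * b.
Proof.
move/bipartP; have [->|nb /(_ isT) [-> le_e hb]] := eqVneq b 0.
  by rewrite !mulr0 raddf0.
rewrite /bipart; case: (h == h'') => /=; last by rewrite mul0r.
have [le_e'|lt_e'] := leqP e' e.
  by rewrite (leq_trans le_e le_e') -(subnK le_e') -addnBA // pihomogMr // addnK.
rewrite mul0r; case: leqP => // le_e''.
by rewrite (pihomogM_lt _ hb) // ltn_sub2r // (leq_ltn_trans le_e'').
Qed.

Lemma bipartMl h e h' e' h'' e'' x b : bipart h e h' e' b = b ->
  bipart h e h'' e'' (b * x) = b * bipart h' e' h'' e'' x.
Proof.
move/bipartP; have [->|nb /(_ isT) [-> le_e hb]] := eqVneq b 0.
  by rewrite !mul0r raddf0.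
rewrite /bipart mulrC; case: (h' == h'') => /=; last by rewrite mulr0.
have [le_e'|lt_e'] := leqP e'' e'.
  rewrite (leq_trans le_e' le_e).
  have -> : (e - e'' = e' - e'' + (e - e'))%N by rewrite addnC addnBA // subnK.
  by rewrite pihomogMr // mulrC.
rewrite mulr0; case: leqP => // le_e''.
by rewrite (pihomogM_lt _ hb) // ltn_sub2l // (leq_trans lt_e').
Qed.

(** Exactness and projectivity give lifts without control of degrees. Being graded means being fixed
    by this projection, so applying it to both sides of an identity, and moving it past graded
    factors with [gpartMr] and [gpartMl], makes such lifts graded. *)
Definition gpart p q (h e : 'I_p -> nat) (h' e' : 'I_q -> nat) (A : 'M[R]_(p, q)) :=
  \matrix_(s, t) bipart (h s) (e s) (h' t) (e' t) (A s t).

Definition graded p q (h e : 'I_p -> nat) (h' e' : 'I_q -> nat) (A : 'M[R]_(p, q)) :=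
  gpart h e h' e' A = A.

Lemma gradedP p q h e h' e' (A : 'M[R]_(p, q)) : graded h e h' e' A <->
  forall s t, A s t != 0 ->
    [/\ h s = h' t, (e' t <= e s)%N & A s t \is (e s - e' t).-homog].
Proof.
split=> [/matrixP E s t|E].
  by apply/bipartP; have := E s t; rewrite mxE.
by apply/matrixP=> s t; rewrite mxE; apply/bipartP/E.
Qed.

Section Theory.
Variables (p q r : nat) (h e : 'I_p -> nat) (h' e' : 'I_q -> nat)
  (h'' e'' : 'I_r -> nat).
Implicit Types (A : 'M[R]_(p, q)) (B : 'M[R]_(q, r)).

Lemma gpart_is_additive : additive (gpart h e h' e').
Proof. by move=> A B; apply/matrixP=> s t; rewrite !mxE raddfB. Qed.

HB.instance Definition _ :=
  GRing.isAdditive.Build _ _ (gpart h e h' e') gpart_is_additive.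

Lemma gpart_graded A : graded h e h' e' (gpart h e h' e' A).
Proof.
apply/gradedP=> s t; rewrite mxE /bipart; case: ifP => [/andP[/eqP-> ->] _|_].
  by split=> //; apply: pihomogP.
by rewrite eqxx.
Qed.

Lemma gpartMr A B : graded h' e' h'' e'' B ->
  gpart h e h'' e'' (A *m B) = gpart h e h' e' A *m B.
Proof.
move/matrixP=> gB; apply/matrixP=> s t; rewrite !mxE raddf_sum.
apply: eq_bigr => j _ /=; rewrite mxE; apply: bipartMr.
by have := gB j t; rewrite mxE.
Qed.

Lemma gpartMl A B : graded h e h' e' A ->
  gpart h e h'' e'' (A *m B) = A *m gpart h' e' h'' e'' B.
Proof.
move/matrixP=> gA; apply/matrixP=> s t; rewrite !mxE raddf_sum.
apply: eq_bigr => j _ /=; rewrite mxE; apply: bipartMl.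
by have := gA s j; rewrite mxE.
Qed.

Lemma gradedM A B : graded h e h' e' A -> graded h' e' h'' e'' B ->
  graded h e h'' e'' (A *m B).
Proof. by move=> gA gB; rewrite /graded gpartMr // gA. Qed.

Lemma gradedB A A' : graded h e h' e' A -> graded h e h' e' A' ->
  graded h e h' e' (A - A').
Proof. by rewrite /graded raddfB /= => -> ->. Qed.

Lemma gradedN A : graded h e h' e' A -> graded h e h' e' (- A).
Proof. by rewrite /graded raddfN /= => ->. Qed.

Lemma graded0 : graded h e h' e' 0.
Proof. exact: raddf0. Qed.

End Theory.

Lemma graded1 p (h e : 'I_p -> nat) : graded h e h e 1%:M.
Proof.
apply/gradedP=> s t; rewrite !mxE; case: (s =P t) => [-> _|_]; last by rewrite eqxx.
by rewrite subnn dhomog1.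
Qed.

Lemma graded_select p q (h e : 'I_q -> nat) (f : 'I_p -> 'I_q) :
  graded (h \o f) (e \o f) h e (rowsub f 1%:M).
Proof.
apply/gradedP=> s t; rewrite !mxE.
by case: (f s =P t) => [<- _|_]; [rewrite subnn dhomog1 | rewrite eqxx].
Qed.

Lemma graded_selectT p q (h e : 'I_q -> nat) (f : 'I_p -> 'I_q) :
  graded h e (h \o f) (e \o f) (rowsub f 1%:M)^T.
Proof.
apply/gradedP=> s t; rewrite !mxE.
by case: (f t =P s) => [<- _|_]; [rewrite subnn dhomog1 | rewrite eqxx].
Qed.

End GradedMatrices.

Arguments graded0 {n k p q h e h' e'}.
Arguments graded1 {n k p} h e.
Arguments graded_select {n k p q} h e f.
Arguments graded_selectT {n k p q} h e f.

(** * Matrices modulo a monomial ideal *)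

Section Congruence.

Variables (n : nat) (k : fieldType).
Notation R := {mpoly k[n]}.
Implicit Types (U : pred 'X_{1..n}).

(** Used as a congruence: [inM U (A - B)] is equality modulo the ideal, which keeps all computations
    among polynomial matrices. *)
Definition inM U p q (A : 'M[R]_(p, q)) := forall i j, A i j \in monideal U.

Lemma eq_inM U U' p q (A : 'M[R]_(p, q)) : U =1 U' -> inM U A -> inM U' A.
Proof. by move=> e hA i j; rewrite -(eq_monideal e). Qed.

Lemma inM0 U p q : inM U (0 : 'M[R]_(p, q)).
Proof. by move=> i j; rewrite mxE rpred0. Qed.

Lemma inMD U p q (A B : 'M[R]_(p, q)) : inM U A -> inM U B -> inM U (A + B).
Proof. by move=> hA hB i j; rewrite mxE rpredD. Qed.

Lemma inMN U p q (A : 'M[R]_(p, q)) : inM U A -> inM U (- A).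
Proof. by move=> hA i j; rewrite mxE rpredN. Qed.

Lemma inMB U p q (A B : 'M[R]_(p, q)) : inM U A -> inM U B -> inM U (A - B).
Proof. by move=> hA hB; apply/inMD/inMN. Qed.

Lemma inM_trans U p q (A B C : 'M[R]_(p, q)) :
  inM U (A - B) -> inM U (B - C) -> inM U (A - C).
Proof. by move=> hA hB; rewrite -(subrKA B); apply: inMD. Qed.

Lemma inMM U p q r (A : 'M[R]_(p, q)) (B : 'M[R]_(q, r)) :
  up_closed U -> inM U B -> inM U (A *m B).
Proof.
by move=> upU hB i j; rewrite mxE; apply: rpred_sum => l _; apply: monidealMl.
Qed.

Lemma inM_gpart U p q (h e : 'I_p -> nat) (h' e' : 'I_q -> nat) (A : 'M[R]_(p, q)) :
  inM U A -> inM U (gpart h e h' e' A).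
Proof.
move=> hA i j; rewrite mxE /bipart; case: ifP => _; last exact: rpred0.
exact: monideal_pihomog.
Qed.

Lemma inM_scaleX U a p q (A : 'M[R]_(p, q)) :
  inM U ('X_[a] *: A) <-> inM (fun m => U (m + a)%MM) A.
Proof. by split=> hA i j; have := hA i j; rewrite mxE mulrC monidealMX. Qed.

End Congruence.

(** * Graded resolutions of monomial ideals *)

Section Glue.

Variables (T : Type) (p q : nat).
Implicit Types (f : 'I_p -> T) (g : 'I_q -> T).

Definition glue f g (i : 'I_(p + q)) : T :=
  match split i with inl j => f j | inr j => g j end.

Lemma glue_lshift f g j : glue f g (lshift q j) = f j.
Proof. by rewrite /glue -/(unsplit (inl j)) unsplitK. Qed.

Lemma glue_rshift f g j : glue f g (rshift p j) = g j.
Proof. by rewrite /glue -/(unsplit (inr j)) unsplitK. Qed.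

End Glue.

Lemma comp_glue (T T' : Type) (u : T -> T') p q (f : 'I_p -> T) (g : 'I_q -> T) :
  (fun i => u (glue f g i)) = glue (u \o f) (u \o g).
Proof. by apply/funext=> i; rewrite /glue; case: split. Qed.

Section Resolutions.

Variables (n : nat) (k : fieldType).
Notation R := {mpoly k[n]}.
Implicit Types (U : pred 'X_{1..n}).

Lemma graded_col p p' q (h e : 'I_p -> nat) (h2 e2 : 'I_p' -> nat)
    (h' e' : 'I_q -> nat) (A : 'M[R]_(p, q)) B :
  graded h e h' e' A -> graded h2 e2 h' e' B ->
  graded (glue h h2) (glue e e2) h' e' (col_mx A B).
Proof.
move=> /gradedP gA /gradedP gB; apply/gradedP=> s t; rewrite mxE /glue.
by case: split => j; [apply: gA | apply: gB].
Qed.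

Lemma graded_row p q q' (h e : 'I_p -> nat) (h' e' : 'I_q -> nat)
    (h2 e2 : 'I_q' -> nat) (A : 'M[R]_(p, q)) B :
  graded h e h' e' A -> graded h e h2 e2 B ->
  graded h e (glue h' h2) (glue e' e2) (row_mx A B).
Proof.
move=> /gradedP gA /gradedP gB; apply/gradedP=> s t; rewrite mxE /glue.
by case: split => j; [apply: gA | apply: gB].
Qed.

(* A graded free resolution of the quotient by [monideal U], all its terms put
   together into one free module with basis 'I_N: [h] is the homological degree,
   [e] the internal degree, and row vectors x are mapped to x *m d by the
   differential and to x *m a by the augmentation, which vanishes on basis
   vectors of positive homological degree. *)
Record gres U N (h e : 'I_N -> nat) (d : 'M[R]_N) (a : 'cV[R]_N) : Prop := Gres {
  gup : up_closed U;
  gdd : d *m d = 0;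
  gd : graded h e (fun t => (h t).+1) e d;
  ga : graded h e (fun=> 0%N) (fun=> 0%N) a;
  gda : inM U (d *m a);
  gunit : exists y : 'rV_N, inM U (y *m a - 1%:M);
  gexact : forall x : 'rV_N, x *m d = 0 -> inM U (x *m a) ->
    exists y : 'rV_N, x = y *m d
}.

Lemma eq_gres U U' N h e (d : 'M_N) a :
  U =1 U' -> gres U h e d a -> gres U' h e d a.
Proof.
move=> eU [up dd gd ga da [y hy] ex]; have eU' := fsym eU.
split=> //; first by move=> m m'; rewrite -!eU; apply: up.
- exact: eq_inM da.
- by exists y; apply: eq_inM hy.
by move=> x xd xa; apply: ex => //; apply: eq_inM xa.
Qed.

Lemma gd_lt U N h e (d : 'M_N) a s t :
  gres U h e d a -> d s t != 0 -> (h t < h s)%N.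
Proof. by move=> G nz; have /gradedP/(_ _ _ nz)[-> _ _] := gd G. Qed.

(** The part of bidegree zero of a preimage of 1 is still a preimage, and it is a cycle because [d]
    lowers the homological degree. Adding multiples of it adjusts augmentations without changing
    boundaries. *)
Lemma gunit_graded U N h e (d : 'M_N) a : gres U h e d a ->
  exists y : 'rV_N, y *m d = 0 /\ inM U (y *m a - 1%:M).
Proof.
move=> G; have [y hy] := gunit G; pose z : 'I_1 -> nat := fun=> 0%N.
exists (gpart z z h e y); split; last first.
  rewrite -(gpartMr _ _ _ (ga G)) -(graded1 z z) -raddfB /=.
  exact: inM_gpart.
have /gradedP gyd := gradedM (gpart_graded z z h e y) (gd G).
apply/matrixP=> i j; rewrite [RHS]mxE; apply/eqP; apply: contraT => nz.
by case: (gyd _ _ nz).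
Qed.

Lemma mulmx_ext N q (u : 'rV[R]_N) (A B : 'M_(N, q)) :
  (forall t, u 0 t != 0 -> row t A = row t B) -> u *m A = u *m B.
Proof.
move=> AB; rewrite !mulmx_sum_row; apply: eq_bigr => t _.
by have [->|/AB->//] := eqVneq (u 0 t) 0; rewrite !scale0r.
Qed.

Lemma inM_mulmx U N q (u : 'rV[R]_N) (A : 'M_(N, q)) : up_closed U ->
  (forall t, u 0 t != 0 -> inM U (row t A)) -> inM U (u *m A).
Proof.
move=> upU hA i j; rewrite mxE; apply: rpred_sum => t _; rewrite (ord1 i).
have [->|nz] := eqVneq (u 0 t) 0; first by rewrite mul0r rpred0.
by apply: monidealMl => //; have := hA t nz 0 j; rewrite mxE.
Qed.

(** Induction along [h']: once the rows of smaller degree are chosen, row s of [d' *m th] is a cycle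
    with augmentation in the ideal, hence a boundary. The column [c] may be nonzero in positive
    degrees, as happens in the horseshoe construction. *)
Lemma gres_lift U N h e (d : 'M_N) a N' (h' : 'I_N' -> nat) (d' : 'M_N')
    (c : 'cV_N') :
  gres U h e d a -> (forall s t, d' s t != 0 -> (h' t < h' s)%N) ->
  d' *m d' = 0 -> inM U (d' *m c) ->
  exists th : 'M_(N', N), th *m d = d' *m th /\ inM U (th *m a - c).
Proof.
move=> G lt_h d'd' d'c; have upU := gup G; have [y0 [y0d y0a]] := gunit_graded G.
suff step L : exists th : 'M_(N', N), forall s, (h' s < L)%N ->
    row s (th *m d) = row s (d' *m th) /\ inM U (row s (th *m a - c)).
  have [th hth] := step (\max_s h' s).+1.
  exists th; split=> [|i j].
    by apply/row_matrixP=> s; have [] := hth s (leq_bigmax s).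
  by have [_ /(_ 0 j)] := hth i (leq_bigmax i); rewrite [row _ _ _ _]mxE.
elim: L => [|L [th hth]]; first by exists 0.
have ext s : exists z : 'rV_N, (h' s <= L)%N ->
    z *m d = row s (d' *m th) /\ inM U (z *m a - row s c).
  have [le_sL|] := leqP (h' s) L; last by exists 0.
  have lt_L t : row s d' 0 t != 0 -> (h' t < L)%N.
    by rewrite mxE => /lt_h lt_ts; apply: leq_trans le_sL.
  have [||y hy] := gexact G (x := row s (d' *m th)).
  - rewrite row_mul -mulmxA (@mulmx_ext _ _ _ _ (d' *m th)).
      by rewrite mulmxA -row_mul d'd' row0 mul0mx.
    by move=> t /lt_L/hth[].
  - rewrite row_mul -mulmxA -[_ *m _](subrK (row s d' *m c)) -mulmxBr.
    apply: inMD; last by move=> i j; rewrite -row_mul mxE.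
    by apply: inM_mulmx => // t /lt_L/hth[].
  (* [y] has the right boundary; a multiple of the cycle [y0] corrects its augmentation. *)
  exists (y + (row s c - y *m a) *m y0) => _; split.
    by rewrite mulmxDl -mulmxA y0d mulmx0 addr0.
  rewrite mulmxDl -mulmxA addrAC -opprB addrC -{2}[row s c - _]mulmx1 -mulmxBr.
  exact: inMM.
have [f hf] := fin_all_exists ext.
pose th' := \matrix_s (if (h' s < L)%N then row s th else f s).
exists th' => s le_sL.
(* Row s of [d'] only involves rows of degree below L, where [th] and [th'] agree. *)
have E : row s (d' *m th') = row s (d' *m th).
  rewrite !row_mul; apply: mulmx_ext => t; rewrite mxE => /lt_h lt_ts.
  by rewrite rowK (leq_trans lt_ts).
rewrite E linearB /= !row_mul rowK; case: ifP => [/hth|_].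
  by rewrite linearB /= !row_mul.
by rewrite -row_mul; apply: hf.
Qed.

(** Only upper bounds are recorded, since the constructions need not yield minimal resolutions; the
    flag [top] separately claims a generator in the extreme bidegree (L, rho + L). *)
Definition has_gres U L rho (top : bool) := exists N (h e : 'I_N -> nat) d a,
  [/\ gres U h e d a, forall s, (h s <= L)%N /\ (e s <= rho + h s)%N &
      top -> exists s, h s = L /\ e s = (rho + L)%N].

Lemma eq_has_gres U U' L rho top :
  U =1 U' -> has_gres U L rho top -> has_gres U' L rho top.
Proof.
by move=> eU [N [h [e [d [a [G hb ht]]]]]]; exists N, h, e, d, a; split=> //;
   apply: eq_gres G.
Qed.

Lemma has_gresW U L L' rho rho' (top top' : bool) :
  (L <= L')%N -> (rho <= rho')%N -> (top' -> [&& top, L == L' & rho == rho']) ->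
  has_gres U L rho top -> has_gres U L' rho' top'.
Proof.
move=> leL le_rho topE [N [h [e [d [a [G hb ht]]]]]]; exists N, h, e, d, a.
split=> // [s|/topE/and3P[/ht hs /eqP <- /eqP <- //]].
have [hs es] := hb s; split; first exact: leq_trans leL.
by rewrite (leq_trans es) ?leq_add2r.
Qed.

Lemma has_gres0 : has_gres pred0 0 0 true.
Proof.
exists 1%N, (fun=> 0%N), (fun=> 0%N), 0, 1%:M; split=> //; last by exists 0.
split; rewrite ?mul0mx //.
- exact: graded0.
- exact: graded1.
- exact: inM0.
- by exists 1%:M; rewrite mulmx1 subrr; apply: inM0.
move=> x _; rewrite mulmx1 => x0; exists 0; rewrite mulmx0.
apply/matrixP=> i j; rewrite mxE; apply/mpolyP=> m; rewrite mcoeff0.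
by apply/eqP; apply: contraT; have /monidealP h := x0 i j => /h.
Qed.

Lemma inM_col U p p' q (A : 'M[R]_(p, q)) (B : 'M_(p', q)) :
  inM U A -> inM U B -> inM U (col_mx A B).
Proof. by move=> hA hB i j; rewrite mxE; case: split => l; [apply: hA | apply: hB]. Qed.

Lemma gpartS p q (h e : 'I_p -> nat) (h' e' : 'I_q -> nat) (A : 'M[R]_(p, q)) :
  gpart (fun s => (h s).+1) e (fun s => (h' s).+1) e' A = gpart h e h' e' A.
Proof. by apply/matrixP=> i j; rewrite !mxE. Qed.

Lemma gradedS p q (h e : 'I_p -> nat) (h' e' : 'I_q -> nat) (A : 'M[R]_(p, q)) :
  graded h e h' e' A -> graded (fun s => (h s).+1) e (fun s => (h' s).+1) e' A.
Proof. by rewrite /graded gpartS. Qed.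

Lemma graded_shift p q w (h e : 'I_p -> nat) (h' e' : 'I_q -> nat) (A : 'M[R]_(p, q)) :
  graded h e h' e' A -> graded h (fun s => e s + w)%N h' (fun s => e' s + w)%N A.
Proof.
move/gradedP=> gA; apply/gradedP=> s t /gA[-> le_e hom].
by rewrite leq_add2r subnDr.
Qed.

Lemma graded_scaleX p q a (h e : 'I_p -> nat) (h' e' : 'I_q -> nat) (A : 'M[R]_(p, q)) :
  graded h e h' e' A -> graded h (fun s => e s + mdeg a)%N h' e' ('X_[a] *: A).
Proof.
move/gradedP=> gA; apply/gradedP=> s t; rewrite mxE.
have [->|/gA[-> le_e hom] _] := eqVneq (A s t) 0; first by rewrite mulr0 eqxx.
split=> //; first exact: leq_trans (leq_addr _ _).
by rewrite addnC -addnBA // dhomogM ?dhomogX.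
Qed.

(* Mapping cone of the multiplication by a monomial regular on the quotient. *)
Lemma has_gres_cone U a L rho top : up_closed U -> (0 < mdeg a)%N ->
  (forall m, U (m + a)%MM = U m) -> has_gres U L rho top ->
  has_gres (fun m => U m || (a <= m)%MM) L.+1 (rho + (mdeg a).-1) top.
Proof.
move=> upU a_gt0 reg [N [h [e [d [b [G hb ht]]]]]].
have upU' : up_closed (fun m => U m || (a <= m)%MM).
  move=> m m' /orP[/upU->//|le_am]; apply/orP; right.
  exact: lepm_trans le_am (lem_addr _ _).
have inMw p q (A : 'M[R]_(p, q)) : inM U A -> inM (fun m => U m || (a <= m)%MM) A.
  move=> hA i j; apply/monidealP=> m nz; apply/orP; left.
  by have /monidealP := hA i j; apply.
(* The second copy is raised by one homological degree and by the degree of the monomial, whence the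
   net shift of rho by [(mdeg a).-1]. *)
exists (N + N)%N, (glue h (S \o h)), (glue e (fun s => e s + mdeg a)%N).
exists (block_mx d 0 'X_[a]%:M (- d)), (col_mx b 0).
split; last first.
- move=> /ht[s [hs es]]; exists (rshift N s).
  by rewrite !glue_rshift /= hs es; split=> //; rewrite -!addnA; congr addn; lia.
- move=> s; rewrite -[s]splitK; case: (split s) => t /=; have [ht1 ht2] := hb t;
    rewrite ?glue_lshift ?glue_rshift /=; lia.
have [y0 [y0d y0a]] := gunit_graded G.
split=> //.
- rewrite mulmx_block (gdd G) !mulmx0 !mul0mx !mulNmx !mulmxN (gdd G) !oppr0 !addr0.
  by rewrite mul_scalar_mx mul_mx_scalar subrr /block_mx !row_mx0 col_mx0.
- rewrite (comp_glue S); apply: graded_col.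
    exact: graded_row (gd G) graded0.
  apply: graded_row; first by rewrite -scalemx1; apply/graded_scaleX/graded1.
  exact/gradedN/(gradedS (graded_shift (mdeg a) (gd G))).
- exact: graded_col (ga G) graded0.
- rewrite mul_block_col mulmx0 addr0 mulmx0 addr0 mul_scalar_mx.
  apply: inM_col; first exact/inMw/(gda G).
  by apply/inM_scaleX=> i j; apply/monidealP=> m _; rewrite lem_addl orbT.
- by exists (row_mx y0 0); rewrite mul_row_col mul0mx addr0; apply: inMw.
move=> x; rewrite -[x]hsubmxK; move: (lsubmx x) (rsubmx x) => u v.
rewrite mul_row_block mul_row_col mul_mx_scalar !mulmx0 add0r addr0 mulmxN -row_mx0.
case/eq_row_mx=> ud /eqP; rewrite oppr_eq0 => /eqP vd ub.
(* Regularity: the cycle condition puts ['X_[a] *: (v *m b)] in the ideal, and translation by [a]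
   leaves [U] unchanged. *)
have vb : inM U (v *m b).
  suff : inM U ('X_[a] *: (v *m b)).
    by move/inM_scaleX; apply: eq_inM.
  move/eqP: ud; rewrite addrC addr_eq0 scalemxAl => /eqP->.
  by rewrite mulNmx -mulmxA; apply/inMN/inMM/(gda G).
have [v' vE] := gexact G vd vb.
have vXb : inM (fun m => U m || (a <= m)%MM) ('X_[a] *: v' *m b).
  rewrite -scalemxAl; apply/inM_scaleX=> i j; apply/monidealP=> m _.
  by rewrite lem_addl orbT.
have [g hg] := monideal_addX (inMD ub vXb 0 0).
(* [u + 'X_[a] *: v'] is a cycle with augmentation congruent to [g * 'X_[a]]; subtracting that
   multiple of [y0] makes it a boundary. *)
pose w := u + 'X_[a] *: v' - (g * 'X_[a]) *: y0.
have [||u' wE] := gexact G (x := w).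
- rewrite /w mulmxBl mulmxDl -!scalemxAl y0d scaler0 subr0 -vE.
  exact: ud.
- rewrite /w mulmxBl mulmxDl.
  apply: (@inM_trans _ _ _ _ _ _ ((g * 'X_[a])%:M)).
    by move=> i j; rewrite !ord1; move: hg; rewrite !mxE eqxx mulr1n.
  rewrite -opprB -scalemx1 -scalemxAl -scalerBr; apply/inMN.
  by rewrite -mul_scalar_mx; apply: inMM.
exists (row_mx u' (g *: y0 - v')); rewrite mul_row_block mulmx0 add0r -wE.
rewrite mul_mx_scalar mulmxN mulmxBl -scalemxAl y0d scaler0 sub0r opprK -vE.
by rewrite /w scalerBr scalerA ['X_[a] * g]mulrC addrA subrK addrK.
Qed.

(* The chain map up to sign [th] corrects the direct sum of the two resolutions
   into a resolution of the middle term of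
   0 -> R/(J : f) -> R/J -> R/(J + f) -> 0, the first map being given by f. *)
Lemma has_gres_horseshoe U a L rho1 rho (top1 top2 top : bool) :
  up_closed U -> (0 < mdeg a)%N -> (rho1 + mdeg a <= rho)%N ->
  (top -> top2 || top1 && (rho1 + mdeg a == rho)%N) ->
  has_gres (fun m => U (m + a)%MM) L rho1 top1 ->
  has_gres (fun m => U m || (a <= m)%MM) L rho top2 ->
  has_gres U L rho top.
Proof.
move=> upU a_gt0 le_rho topE [N1 [h1 [e1 [d1 [b1 [G1 hb1 ht1]]]]]].
move=> [N2 [h2 [e2 [d2 [b2 [G2 hb2 ht2]]]]]].
set U1 := fun m => U (m + a)%MM in G1; set U2 := fun m => _ || _ in G2.
pose f : R := 'X_[a].
have inU1 p q (A : 'M[R]_(p, q)) : inM U1 A <-> inM U (f *: A).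
  exact: iff_sym (inM_scaleX _ _ _).
(* Boundaries of [G2] augment into J + (f); [c] records the coefficient of f, the obstruction to
   using [b2] modulo J alone. *)
have [c hc] := fin_all_exists (fun s => monideal_addX (gda G2 s 0)).
pose c0 : 'cV[R]_N2 := \col_s c s.
have dbc : inM U (d2 *m b2 - f *: c0).
  by move=> i j; have := hc i; rewrite !ord1 !mxE [f * _]mulrC.
(* [c0] is a cocycle modulo J : f, since f d2 c0 is congruent to d2 d2 b2 = 0 modulo J. *)
have dc : inM U1 (- d2 *m - c0).
  rewrite mulNmx mulmxN opprK; apply/inU1.
  have -> : f *: (d2 *m c0) = - (d2 *m (d2 *m b2 - f *: c0)).
    by rewrite mulmxBr mulmxA (gdd G2) mul0mx sub0r opprK scalemxAr.
  exact/inMN/inMM.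
have [th0 [th0d th0b]] : exists th : 'M_(N2, N1),
    th *m d1 = - d2 *m th /\ inM U1 (th *m b1 - - c0).
  apply: (gres_lift (h' := h2) G1) => //; last by rewrite mulNmx mulmxN opprK (gdd G2).
  by move=> s t; rewrite mxE oppr_eq0; apply: gd_lt G2.
(* The first resolution enters through multiplication by f, which shifts its internal degrees; [h1']
   is raised by one because [th] lowers the homological degree. *)
pose e1' s := (e1 s + mdeg a)%N; pose h1' s := (h1 s).+1.
pose th := gpart h2 e2 h1' e1' th0.
have gd1 : graded h1' e1' (fun s => (h1' s).+1) e1' d1.
  exact: gradedS (graded_shift (mdeg a) (gd G1)).
have gfb1 : graded h1 e1' (fun=> 0%N) (fun=> 0%N) (f *: b1).
  exact: graded_scaleX (ga G1).
have thd : th *m d1 + d2 *m th = 0.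
  have := congr1 (gpart h2 e2 (fun s => (h1' s).+1) e1') th0d.
  rewrite (gpartMr _ _ _ gd1) mulNmx raddfN /= (gpartMl _ _ _ (gd G2)) gpartS => ->.
  by rewrite addNr.
have thb : inM U (d2 *m b2 + th *m (f *: b1)).
  have : inM U (d2 *m b2 + th0 *m (f *: b1)).
    rewrite opprK in th0b; have := inMD dbc (proj1 (inU1 _ _ _) th0b).
    by rewrite scalerDr addrA addrAC subrK scalemxAr.
  move/(inM_gpart h2 e2 (fun=> 1%N) (fun=> 0%N)); rewrite raddfD /=.
  rewrite (gpartMr _ _ _ (gradedS gfb1)) (gpartMl _ _ _ (gd G2)) gpartS.
  by rewrite (ga G2).
have UU2 p q (A : 'M[R]_(p, q)) : inM U A -> inM U2 A.
  move=> hA i j; apply/monidealP=> m nz; apply/orP; left.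
  by have /monidealP := hA i j; apply.
have fU2 p q (A : 'M[R]_(p, q)) : inM U2 (f *: A).
  by apply/inM_scaleX=> i j; apply/monidealP=> m _; rewrite /U2 lem_addl orbT.
exists (N1 + N2)%N, (glue h1 h2), (glue e1' e2), (block_mx d1 0 th d2).
exists (col_mx (f *: b1) b2); split; last first.
- move=> /topE/orP[/ht2[s [hs es]]|/andP[/ht1[s [hs es]] /eqP <-]].
    by exists (rshift N1 s); rewrite !glue_rshift.
  by exists (lshift N2 s); rewrite !glue_lshift /e1' es addnAC.
- move=> s; rewrite -[s]splitK; case: (split s) => t /=.
    by rewrite !glue_lshift; have := hb1 t; rewrite /e1'; lia.
  by rewrite !glue_rshift; have := hb2 t; lia.
split=> //.
- rewrite mulmx_block (gdd G1) (gdd G2) thd !mulmx0 !mul0mx !addr0.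
  by rewrite /block_mx !row_mx0 col_mx0.
- rewrite (comp_glue S); apply: graded_col.
    exact: graded_row (graded_shift (mdeg a) (gd G1)) graded0.
  exact: graded_row (gpart_graded _ _ _ _ _) (gd G2).
- exact: graded_col gfb1 (ga G2).
- rewrite mul_block_col mul0mx addr0 [th *m _ + _]addrC.
  by apply: inM_col => //; rewrite -scalemxAr; apply/inU1/(gda G1).
- have [y2 hy2] := gunit G2; have [y1 hy1] := gunit G1.
  (* [y2] maps to 1 + g f modulo J; the term g f is removed with a preimage [y1] of 1 modulo J :
     f. *)
  have [g hg] := monideal_addX (hy2 0 0).
  exists (row_mx (- g *: y1) y2); rewrite mul_row_col.
  have -> : - g *: y1 *m (f *: b1) + y2 *m b2 - 1%:M =
     (y2 *m b2 - 1%:M - (g * f)%:M) - g%:M *m (f *: (y1 *m b1 - 1%:M)).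
    rewrite mul_scalar_mx -scalemxAl -scalemxAr scaleNr scalerBr scalerBr.
    have E (V : zmodType) (A B C D : V) : - A + B - C = B - C - D - (A - D).
      by rewrite opprB addrA subrK -addrA addrC.
    by rewrite !scalerA scalemx1; apply: E.
  apply: inMB; last exact/inMM/inU1.
  by move=> i j; move: hg; rewrite !ord1 !mxE eqxx !mulr1n.
move=> x; rewrite -[x]hsubmxK; move: (lsubmx x) (rsubmx x) => u v.
rewrite mul_row_block mul_row_col !mulmx0 add0r -row_mx0 => /eq_row_mx[ud vd] ub.
have vb : inM U2 (v *m b2).
  rewrite -[v *m b2](addKr (u *m (f *: b1))) addrC -scalemxAr.
  by apply: inMB => //; rewrite scalemxAr; apply: UU2.
have [v' vE] := gexact G2 vd vb.
(* Subtracting the total boundary of [(0, v')] from x leaves an element of the first summand. *)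
have [||u' uE] := gexact G1 (x := u - v' *m th).
- rewrite mulmxBl -mulmxA -[th *m d1](addrK (d2 *m th)) thd sub0r mulmxN opprK.
  by rewrite mulmxA -vE.
- apply/inU1; rewrite scalemxAr mulmxBl -mulmxA.
  rewrite -[th *m _](addKr (d2 *m b2)) mulmxDr mulmxN mulmxA -vE.
  rewrite opprD opprK addrA; apply: inMB => //; exact: inMM.
exists (row_mx u' v'); rewrite mul_row_block mulmx0 add0r -vE -uE.
by rewrite subrK.
Qed.

End Resolutions.

(** * Edge ideals of rooted graphs *)

Section Acyclic.

Variables (n : nat) (D : wograph n) (r : 'I_n).
Hypothesis hroot : rooted D r.

(* If the strong component C of x and y were nontrivial, a simple path from the
   root could be continued, from the first vertex z of C that it meets, to a
   predecessor of z in C, contradicting [rooted_orientation]. *)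
Lemma rooted_acyclic x y : edge D x y -> ~~ connect (edge D) y x.
Proof.
move=> exy; apply/negP=> cyx.
pose C z := connect (edge D) y z && connect (edge D) z x.
have Cy : C y by rewrite /C connect0.
have Cconn z z' : C z -> C z' -> connect (edge D) z z'.
  case/andP=> _ czx /andP[cyz' _]; apply: connect_trans czx _.
  exact: connect_trans (connect1 exy) cyz'.
have Cpred z : C z -> exists2 z', C z' & edge D z' z.
  move=> Cz; have [zy|zy] := eqVneq z y.
    by exists x; rewrite ?zy // /C cyx connect0.
  have /connectP[p pp zE] := Cconn _ _ Cy Cz.
  case/lastP: p pp zE => [_ /eqP|p z0]; first by rewrite (negPf zy).
  rewrite rcons_path last_rcons => /andP[pp ez0] zE; rewrite -zE in ez0.
  exists (last y p) => //; have /andP[_ czx] := Cz; apply/andP; split.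
    by apply/connectP; exists p.
  exact: connect_trans (connect1 ez0) czx.
have [p /andP[pp up] py] := rooted_path hroot y.
move sE: (r :: p) => s; have hasC : has C s.
  by apply/hasP; exists y => //; rewrite -sE -py mem_last.
case: (split_find hasC) sE => z s1 s2 Cz s1C {s hasC}.
have [z' Cz' ez'z] := Cpred z Cz.
case: s1 s1C => [_ [rz _]|r0 s1 s1C [r0E pE]].
  have /(_ z')/negP[] : source D r by apply/(rooted_sourceP hroot).
  by rewrite rz.
have /connectP[q0 pq0 z'E] := Cconn _ _ Cz Cz'.
move: z'E; case/shortenP: pq0 => q pq uq _ z'E.
(* The path from z to its predecessor never leaves C, so it cannot meet [s1], which avoids C; the
   concatenated path is therefore simple. *)
have qC : all C q.
  apply/allP=> u uq'; have /andP[_ cux] : C z' by [].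
  case/splitPr: uq' pq z'E => q1 q2; rewrite cat_path last_cat /=.
  move=> /and3P[pq1 eu pq2] z'E; apply/andP; split.
    have /andP[cyz _] := Cz; apply: connect_trans cyz _; apply/connectP.
    by exists (rcons q1 u); rewrite ?rcons_path ?pq1 ?last_rcons.
  by apply: connect_trans cux; apply/connectP; exists q2.
have zq : z' \in q.
  case: q pq uq z'E qC => [_ _ zz'|u q _ _ -> _]; last exact: (mem_last u q).
  by rewrite zz' /= edge_irr in ez'z.
have adj : adjacent D z z' by rewrite /adjacent ez'z orbT.
suff /(rooted_orientation hroot adj) :
    exists2 p0, oriented_path D r p0 & mem2 (r :: p0) z z'.
  by move/edge_asym; rewrite ez'z.
exists (rcons s1 z ++ q); last first.
  by rewrite -cat_cons mem2_cat zq andbT inE mem_rcons mem_head !orbT.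
apply/andP; split.
  by move: pp; rewrite pE !cat_path last_rcons => /andP[-> _].
have us : uniq (rcons (r :: s1) z).
  by move: up; rewrite pE -cat_cons -rcons_cons cat_uniq => /andP[].
move: uq; rewrite -cat_cons -rcons_cons cat_uniq us /= => /andP[zq' ->].
rewrite andbT; apply/hasPn=> u uq0.
rewrite /= -rcons_cons mem_rcons inE negb_or; apply/andP; split.
  by apply: contraNneq zq' => <-.
by apply: contra s1C => us1; apply/hasP; exists u; rewrite -?r0E //; apply: (allP qC).
Qed.

(** The number of vertices reachable from x drops along an edge, as its tail is not reachable from
    its head. A minimum of such a rank on a vertex set is a sink of the induced subgraph. *)
Lemma rooted_rank : exists f : 'I_n -> nat, forall x y, edge D x y -> (f y < f x)%N.
Proof.
exists (fun x => #|connect (edge D) x|) => x y exy; apply/proper_card/properP; split.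
  by apply/subsetP=> z; apply: connect_trans (connect1 exy).
by exists x; [exact: connect0 | exact: rooted_acyclic].
Qed.

Lemma rooted_in_edge v : v != r -> exists u, edge D u v.
Proof.
move=> vr; apply/existsP; apply: contraTT vr => /existsPn srcv; rewrite negbK.
by apply/eqP/(rooted_sourceP hroot).
Qed.

End Acyclic.

(** * Induced subgraphs and removal of a sink *)

Section EdgeMonomials.

Variables (n : nat) (k : fieldType) (D : wograph n).
Implicit Types (V W : {set 'I_n}) (m : 'X_{1..n}).

(** Induced subgraphs are vertex sets and not new [wograph]s: a vertex that becomes a source keeps
    its weight, which [weight_source] would forbid, and the polynomial ring stays fixed. *)
Definition edge_mon V : pred 'X_{1..n} := fun m =>
  [exists i in V, [exists j in V, [&& edge D i j, 0 < m i & weight D j <= m j]]]%N.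

Lemma edge_monP V m : reflect
  (exists i j, [/\ i \in V, j \in V, edge D i j, 0 < m i & weight D j <= m j]%N)
  (edge_mon V m).
Proof.
apply: (iffP exists_inP) => [[i iV /exists_inP[j jV /and3P[]]]|[i [j []]]].
  by exists i, j.
by move=> iV jV e mi mj; exists i => //; apply/exists_inP; exists j => //; apply/and3P.
Qed.

Lemma edge_mon_up V : up_closed (edge_mon V).
Proof.
move=> m m' /edge_monP[i [j [iV jV e mi mj]]]; apply/edge_monP; exists i, j.
by rewrite !mnmDE; split=> //; lia.
Qed.

Lemma mnm1_lep v w m : (U_(v) *+ w <= m)%MM = (w <= m v)%N.
Proof.
apply/mnm_lepP/idP => [/(_ v)|le_w i]; first by rewrite mulmnE mnm1E eqxx mul1n.
by rewrite mulmnE mnm1E; case: eqP => [<-|_]; rewrite ?mul1n.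
Qed.

Lemma mdegU v w : mdeg (U_(v) *+ w : 'X_{1..n})%MM = w.
Proof. by rewrite mdegMn mdeg1 mul1n. Qed.

Lemma mnm_addU_neq v w m i : i != v -> (m + U_(v) *+ w)%MM i = m i.
Proof. by move=> ne; rewrite mnmDE mulmnE mnm1E eq_sym (negPf ne) addn0. Qed.

(** The variable x_v does not occur in the generators for [V], so its powers are regular, as the
    mapping cone requires. *)
Lemma edge_mon_addU V v w m : v \notin V -> edge_mon V (m + U_(v) *+ w)%MM = edge_mon V m.
Proof.
move=> vV; have neq i : i \in V -> i != v by apply: contraTneq => ->.
by apply/edge_monP/edge_monP=> -[i [j [iV jV e mi mj]]]; exists i, j; split=> //;
   move: mi mj; rewrite !mnm_addU_neq ?neq.
Qed.

(** Each new variable is regular of degree 1: its cone adds one to the length and nothing to rho. *)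
Lemma has_gres_vars W (s : seq 'I_n) L rho (top : bool) :
  uniq s -> all (fun p => p \notin W) s ->
  has_gres k (edge_mon W) L rho top ->
  has_gres k (fun m => edge_mon W m || has (fun p => 0 < m p)%N s) (L + size s) rho top.
Proof.
elim: s => [_ _|p s IHs /= /andP[ps us] /andP[pW sW] G].
  by rewrite addn0; apply: eq_has_gres => m; rewrite orbF.
have {IHs G} := has_gres_cone (a := (U_(p) *+ 1)%MM) _ _ _ (IHs us sW G).
rewrite mdegU addnS addn0 => cone; apply: eq_has_gres (cone _ _ _) => //.
- by move=> m; rewrite mnm1_lep -orbA [has _ s || _]orbC.
- move=> m m' /orP[/edge_mon_up->//|/hasP[q qs mq]]; apply/orP; right.
  by apply/hasP; exists q => //; rewrite mnmDE; lia.
move=> m; rewrite edge_mon_addU //; congr orb; apply: eq_in_has => q qs.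
by rewrite mnm_addU_neq //; apply: contraTneq qs => ->.
Qed.

Section Sink.

Variables (V : {set 'I_n}) (v : 'I_n).
Hypotheses (vV : v \in V) (sink : forall u, u \in V -> ~~ edge D v u).

Notation w := (weight D v).
Definition in_nbrs := [set u in V | edge D u v].

Lemma in_nbrs_sub : in_nbrs \subset V :\ v.
Proof.
apply/subsetP=> u; rewrite !inE => /andP[-> e]; rewrite andbT.
by apply: contraTneq e => ->; rewrite edge_irr.
Qed.

(** Dividing by x_v^w turns the generator of an edge from p to v into x_p, and the generator of any
    other edge at p is a multiple of x_p. *)
Lemma edge_mon_colon m :
  (edge_mon (V :\ v :\: in_nbrs) m || has (fun p => 0 < m p)%N (enum in_nbrs)) =
  edge_mon V (m + U_(v) *+ w)%MM.
Proof.
apply/orP/edge_monP => [[/edge_monP[i [j [iV jV e mi mj]]]|]|[i [j [iV jV e]]]].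
- exists i, j; move: iV jV; rewrite !inE !mnmDE => /and3P[_ _ ->] /and3P[_ _ ->].
  by split=> //; lia.
- case/hasP=> p; rewrite mem_enum inE => /andP[pV e] mp; exists p, v.
  by split=> //; rewrite !mnmDE ?mulmnE ?mnm1E ?eqxx; lia.
have iv : i != v by apply: contraTneq e => ->; apply: sink.
rewrite mnm_addU_neq // => mi mj.
have [iP|iP] := boolP (i \in in_nbrs).
  by right; apply/hasP; exists i; rewrite ?mem_enum.
have jv : j != v by apply: contraNneq iP => jv; rewrite inE iV -[X in edge D i X]jv.
rewrite mnm_addU_neq // in mj.
have [jP|jP] := boolP (j \in in_nbrs).
  right; apply/hasP; exists j; rewrite ?mem_enum //.
  exact: leq_trans (weight_gt0 D j) mj.
left; apply/edge_monP; exists i, j; split=> //.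
  by rewrite in_setD iP in_setD1 iv.
by rewrite in_setD jP in_setD1 jv.
Qed.

(** As v is a sink, the generators lost with it are multiples of x_v^w. *)
Lemma edge_mon_sum m : (edge_mon (V :\ v) m || (U_(v) *+ w <= m)%MM) =
  (edge_mon V m || (U_(v) *+ w <= m)%MM).
Proof.
rewrite mnm1_lep; apply/orP/orP=> -[|->]; try by right.
  move/edge_monP=> [i [j []]]; rewrite !inE => /andP[_ iV] /andP[_ jV] e mi mj.
  by left; apply/edge_monP; exists i, j.
move/edge_monP=> [i [j [iV jV e mi mj]]]; have [jv|jv] := eqVneq j v.
  by right; rewrite -jv.
left; apply/edge_monP; exists i, j; rewrite !inE jv iV jV; split=> //.
by rewrite andbT; apply: contraTneq e => ->; apply: sink.
Qed.

(* Removing a sink v: the colon by x_v^w is the edge ideal of the graph without v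
   and its in-neighbours plus the variables of these in-neighbours. *)
Lemma has_gres_sink L rho rho1 rho2 (top top1 top2 : bool) :
  has_gres k (edge_mon (V :\ v :\: in_nbrs)) #|V :\ v :\: in_nbrs| rho1 top1 ->
  has_gres k (edge_mon (V :\ v)) L rho2 top2 ->
  (#|V :\ v| <= L.+1)%N -> (top1 -> #|V :\ v| = L.+1) ->
  (rho1 + w <= rho)%N -> (rho2 + w.-1 <= rho)%N ->
  (top -> top1 && (rho1 + w == rho)%N || top2 && (rho2 + w.-1 == rho)%N) ->
  has_gres k (edge_mon V) L.+1 rho top.
Proof.
move=> G1 G2 leL topL le1 le2 topE.
(* Deleting the in-neighbours and then adding their variables resolves the colon in length
   [#|V :\ v|]. *)
have sizeP : (#|V :\ v :\: in_nbrs| + size (enum in_nbrs))%N = #|V :\ v|.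
  by rewrite -cardE -(cardsID in_nbrs (V :\ v)) (setIidPr in_nbrs_sub) addnC.
have w_gt0 := weight_gt0 D v.
apply: (has_gres_horseshoe (a := (U_(v) *+ w)%MM) (rho1 := rho1) (top1 := top1)
  (top2 := top2 && (rho2 + w.-1 == rho)%N)); rewrite ?mdegU //.
- exact: edge_mon_up.
- by move/topE; rewrite orbC.
- apply: (eq_has_gres edge_mon_colon).
  apply: has_gresW (has_gres_vars _ _ G1); rewrite ?sizeP ?enum_uniq //.
    by move=> t1; rewrite t1 eqxx (topL t1) eqxx.
  by apply/allP=> p; rewrite mem_enum in_setD => ->.
apply: (eq_has_gres edge_mon_sum).
apply: has_gresW (has_gres_cone _ _ _ G2); rewrite ?mdegU //.
- by case/andP=> -> ->; rewrite eqxx.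
- exact: edge_mon_up.
by move=> m; rewrite edge_mon_addU // setD11.
Qed.

End Sink.

Variable f : 'I_n -> nat.
Hypothesis f_lt : forall x y, edge D x y -> (f y < f x)%N.

Lemma edge_mon_extend V v : v \in V -> (forall u, u \in V -> ~~ edge D v u) ->
  (forall u, u \in V -> ~~ edge D u v) -> edge_mon (V :\ v) =1 edge_mon V.
Proof.
move=> vV outv inv m; apply/edge_monP/edge_monP=> -[i [j [iV jV e mi mj]]]; exists i, j.
  by move: iV jV; rewrite !inE => /andP[_ ->] /andP[_ ->].
rewrite !inE iV jV; split=> //; rewrite andbT; apply: contraTneq e => ->.
  exact: outv.
exact: inv.
Qed.

Lemma edge_mon_set1 v : edge_mon [set v] =1 pred0.
Proof.
move=> m; apply/edge_monP=> -[i [j []]]; rewrite !inE => /eqP-> /eqP->.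
by rewrite edge_irr.
Qed.

Lemma edge_mon_set0 : edge_mon set0 =1 pred0.
Proof. by move=> m; apply/edge_monP=> -[i [j []]]; rewrite inE. Qed.

(** The colon side must absorb w_v, whereas v contributes max(1, w_v - 1), possibly one less. A
    deleted in-neighbour makes up the difference, which is why every vertex counts at least 1. *)
Lemma has_gres_edges V :
  has_gres k (edge_mon V) #|V| (\sum_(i in V) maxn 1 (weight D i).-1) false.
Proof.
have [N] := ubnP #|V|; elim: N => // N IHN in V * => ltVN.
have [->|/set0Pn[v0 v0V]] := eqVneq V set0.
  rewrite cards0 big_set0; apply: eq_has_gres (has_gresW _ _ _ (has_gres0 _ _)) => //.
  by move=> m; rewrite edge_mon_set0.
pose v := [arg min_(v < v0 in V) f v].
have [vV vmin] : v \in V /\ forall u, u \in V -> (f v <= f u)%N.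
  by rewrite /v; case: arg_minnP.
have sink u : u \in V -> ~~ edge D v u.
  by move/vmin=> le; apply: contraL le => /f_lt; rewrite -ltnNge.
have cardV : #|V| = #|V :\ v|.+1 by rewrite (cardsD1 v) vV.
rewrite (big_setD1 v vV) /= cardV; rewrite cardV ltnS in ltVN.
have [P0|/set0Pn[p pP]] := eqVneq (in_nbrs V v) set0.
  apply: (eq_has_gres (edge_mon_extend vV sink _)).
    by move=> u uV; apply/negP=> e; have := in_set0 u; rewrite -P0 inE uV e.
  by apply: has_gresW (IHN _ ltVN); rewrite ?leq_addl.
apply: (has_gres_sink vV sink (IHN _ _) (IHN _ ltVN)) => //.
- by apply: leq_ltn_trans ltVN; rewrite subset_leq_card ?subsetDl.
- rewrite [X in (_ <= _ + X)%N](big_setID (in_nbrs V v)) (setIidPr (in_nbrs_sub _ _)) /=.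
  rewrite (big_setD1 p pP) /= addnA addnC leq_add2r.
  move: (weight D v) (weight D p) => a b. lia.
by rewrite addnC leq_add2r leq_maxr.
Qed.

Variable r : 'I_n.
Hypotheses (r_source : forall u, ~~ edge D u r)
  (hw : forall i, i != r -> (2 <= weight D i)%N).

(** Having a predecessor inside V stands in for rootedness and survives the removal of a sink. For V
    = {r} the ideal is zero and the bound 1 is not attained, hence the flag [1 < #|V|]. *)
Lemma has_gres_rooted V : r \in V ->
  (forall v, v \in V -> v != r -> exists2 u, u \in V & edge D u v) ->
  has_gres k (edge_mon V) #|V|.-1 (\sum_(i in V :\ r) (weight D i).-1).+1 (1 < #|V|)%N.
Proof.
have [N] := ubnP #|V|; elim: N => // N IHN in V * => ltVN rV inV.
have [V0|/set0Pn[v0 v0V]] := eqVneq (V :\ r) set0.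
  have -> : V = [set r] by rewrite -(setD1K rV) V0 setU0.
  rewrite cards1; apply: eq_has_gres (has_gresW _ _ _ (has_gres0 _ _)) => //.
  by move=> m; rewrite edge_mon_set1.
pose v := [arg min_(v < v0 in V :\ r) f v].
have [vVr vmin] : v \in V :\ r /\ forall u, u \in V :\ r -> (f v <= f u)%N.
  by rewrite /v; case: arg_minnP.
have [vr vV] := setD1P vVr.
have sink u : u \in V -> ~~ edge D v u.
  have [->|ur uV] := eqVneq u r; first by [].
  have := vmin u; rewrite in_setD1 ur uV => /(_ isT) le.
  by apply: contraL le => /f_lt; rewrite -ltnNge.
have cardV : #|V| = #|V :\ v|.+1 by rewrite (cardsD1 v) vV.
have rVv : r \in V :\ v by rewrite in_setD1 eq_sym vr.
have IH : has_gres k (edge_mon (V :\ v)) #|V :\ v|.-1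
    (\sum_(i in V :\ v :\ r) (weight D i).-1).+1 (1 < #|V :\ v|)%N.
  apply: IHN => //; first by rewrite -cardV.
  move=> u /setD1P[uv uV] ur; have [u' u'V e] := inV u uV ur.
  exists u' => //; rewrite in_setD1 u'V andbT; apply: contraTneq e => ->; exact: sink.
have [p pV e] := inV v vV vr.
have pP : p \in in_nbrs V v by rewrite inE pV.
have Vv_gt0 : (0 < #|V :\ v|)%N by apply/card_gt0P; exists r.
have w2 := hw vr.
have sumE : (\sum_(i in V :\ r) (weight D i).-1 =
    (weight D v).-1 + \sum_(i in V :\ v :\ r) (weight D i).-1)%N.
  by rewrite (big_setD1 v vVr) /= setDDl setUC -setDDl.
rewrite cardV -[X in has_gres _ _ X](prednK Vv_gt0) sumE.
pose W := V :\ v :\: in_nbrs V v.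
have eW : W :\ r = V :\ v :\ r :\: in_nbrs V v.
  by apply/setP=> u; rewrite !in_setD !in_set1; case: (u == r); rewrite ?andbF.
(* If only the edge from r to v is left, the extremal generator comes from the colon R/(x_r), with
   rho1 = 0 shifted by w_v. *)
have [Vv1|Vv1] := leqP #|V :\ v| 1.
  have Vv : V :\ v = [set r].
    apply/esym/eqP; rewrite eqEcard sub1set rVv.
    by rewrite cards1.
  have pr : p = r.
    by apply/set1P; rewrite -Vv; apply: (subsetP (in_nbrs_sub _ _)).
  have W0 : W = set0.
    by apply/setP=> u; rewrite /W Vv in_setD in_set1 in_set0; case: eqP => [->|_];
      rewrite ?andbF // -pr pP.
  have G1 : has_gres k (edge_mon W) #|W| 0 true.
    rewrite W0 cards0; apply: eq_has_gres (has_gres0 _ _) => m; by rewrite edge_mon_set0.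
  rewrite [X in (_ + X)%N]big1 ?addn0 => [|i]; last first.
    by rewrite Vv setDv in_set0.
  apply: (has_gres_sink vV sink G1 IH); rewrite -/W ?Vv ?cards1 ?setDv ?big_set0 //=;
    by rewrite ?addn0 ?add0n ?add1n ?prednK ?weight_gt0 ?eqxx.
(* Here V - v supplies the extremal generator, and the colon only has to obey the bound. *)
apply: (has_gres_sink vV sink (has_gres_edges _) IH) => //; rewrite -/W.
- by rewrite prednK.
- have le_W (X : {set 'I_n}) : r \notin X ->
      \sum_(i in X) maxn 1 (weight D i).-1 = \sum_(i in X) (weight D i).-1.
    move=> rX; apply: eq_bigr => i iX; apply/maxn_idPr; rewrite -subn1 subn_gt0 hw //.
    by apply: contraTneq iX => ->.
  rewrite -addSn (prednK (weight_gt0 D v)) [X in (X <= _)%N]addnC leq_add2l.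
  rewrite [X in (_ <= X)%N](big_setID (in_nbrs V v)) /= -eW.
  have [rW|rW] := boolP (r \in W); last first.
    have -> : W :\ r = W by apply/setDidPl; rewrite disjoint_sym disjoints1.
    by rewrite le_W // leq_addl.
  rewrite (big_setD1 r rW) /= le_W ?setD11 // (weight_source r_source) leq_add2r.
  have pr : p != r by apply: contraTneq rW => <-; rewrite in_setD pP.
  have pA : p \in (V :\ v :\ r) :&: in_nbrs V v.
    by rewrite in_setI pP in_setD1 pr (subsetP (in_nbrs_sub _ _)).
  by rewrite (big_setD1 p pA) /= ltn_addr // -subn1 subn_gt0 hw.
- by rewrite addSn addnC.
by move=> _; rewrite Vv1 /= addSn addnC.
Qed.

End EdgeMonomials.

(** * Minimal resolutions *)

Section Minimal.

Variables (n : nat) (k : fieldType).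
Notation R := {mpoly k[n]}.
Implicit Types (U : pred 'X_{1..n}).

(** [p *m i] is an idempotent chain map respecting the augmentation, and the smaller complex is its
    image: [i] carries cycles into the large resolution and [p] carries the bounding chains back. *)
Lemma gres_retract U N N' h e (d : 'M[R]_N) a (h' e' : 'I_N' -> nat)
    (i : 'M_(N', N)) (p : 'M_(N, N')) :
  gres U h e d a -> graded h' e' h e i -> graded h e h' e' p ->
  i *m p = 1%:M -> (p *m i) *m d = d *m (p *m i) -> inM U (p *m i *m a - a) ->
  gres U h' e' (i *m d *m p) (i *m a).
Proof.
move=> G gi gp ip1 pid pia; have upU := gup G.
have iE : i *m (p *m i) = i by rewrite mulmxA ip1 mul1mx.
have pE : p *m i *m p = p by rewrite -mulmxA ip1 mulmx1.
have idp_i : i *m d *m p *m i = i *m d.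
  by rewrite -!mulmxA -pid mulmxA iE.
split=> //.
- by rewrite !mulmxA idp_i -[i *m d *m d]mulmxA (gdd G) mulmx0 mul0mx.
- exact: gradedM (gradedM gi (gd G)) (gradedS gp).
- exact: gradedM gi (ga G).
- by rewrite mulmxA idp_i -mulmxA; apply/inMM/(gda G).
- have [y hy] := gunit G; exists (y *m p); apply: inM_trans hy.
  by rewrite !mulmxA -[y *m p *m i]mulmxA -!mulmxA -mulmxBr mulmxA; apply: inMM.
move=> x xd xa; have [||y hy] := gexact G (x := x *m i).
- by rewrite -mulmxA -idp_i [x *m _]mulmxA xd mul0mx.
- by rewrite -mulmxA.
have pdE : p *m (i *m d *m p) = d *m p by rewrite !mulmxA pid -mulmxA pE.
by exists (y *m p); rewrite -[LHS]mulmx1 -ip1 mulmxA hy -[RHS]mulmxA pdE mulmxA.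
Qed.

(* Cancellation of two basis vectors joined by a unit entry of the differential. *)
Lemma gres_cancel U N h e (d : 'M[R]_N) a r c :
  gres U h e d a -> (d r c)@_0%MM != 0 ->
  h r = (h c).+1 /\ e r = e c /\
  exists N' (f : 'I_N' -> 'I_N) (d' : 'M[R]_N') a', [/\ (N' < N)%N,
    gres U (h \o f) (e \o f) d' a' &
    forall s, s != r -> s != c -> exists t, f t = s].
Proof.
move=> G nz; have drc : d r c != 0 by apply: contraNneq nz => ->; rewrite mcoeff0.
have [hrc le_e hom] : [/\ h r = (h c).+1, (e c <= e r)%N & d r c \is (e r - e c).-homog].
  by have /gradedP/(_ r c drc) := gd G.
have erc : e r = e c.
  have := dhomogP _ _ _ hom 0%MM; rewrite mcoeff_msupp nz mf0 => /(_ isT); lia.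
split=> //; split=> //; rewrite erc subnn in hom.
have := homog0_const hom; set u := _@__ in nz * => du.
have rc : r != c by apply: contra_eq_neq hrc => ->; rewrite neq_ltn leqnn.
(* A homotopy inverting the unit entry. Then 1 - d E - E d is a projection whose kernel is spanned
   by the basis vector r and its boundary; [p *m i] below is a factorisation of it. *)
pose E : 'M[R]_N := (u^-1)%:MP *: delta_mx c r.
have vu : (u^-1)%:MP * d r c = 1 by rewrite du -mpolyCM mulVf.
have dl (A : 'M[R]_N) i j i' j' :
    delta_mx i j *m A *m delta_mx i' j' = A j i' *: delta_mx i j'.
  apply/matrixP=> x y; rewrite !mxE (bigD1 i') //= big1 => [|z zi]; last first.
    by rewrite !mxE (negPf zi) mulr0.
  rewrite !mxE (bigD1 j) //= big1 => [|z zj]; last by rewrite !mxE (negPf zj) andbF mul0r.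
  by rewrite !mxE !eqxx andbT; case: (x == i); case: (y == j');
    rewrite ?mul1r ?mul0r ?mulr1 ?mulr0 ?addr0.
have EE : E *m E = 0.
  have := dl _ _ 1%:M c r c r; rewrite mulmx1 mxE (negPf rc) scale0r => dd.
  by rewrite /E -scalemxAl -scalemxAr dd !scaler0.
pose A := [set~ r] :\ c; pose f : 'I_#|A| -> 'I_N := enum_val.
have fr s : f s != r by have := enum_valP s; rewrite !inE => /andP[].
have fc s : f s != c by have := enum_valP s; rewrite !inE => /andP[].
have onto s : s != r -> s != c -> exists t, f t = s.
  move=> sr sc; have sA : s \in A by rewrite !inE sr sc.
  by exists (enum_rank_in sA s); apply: enum_rankK_in.
exists #|A|, f; pose S : 'M[R]_(#|A|, N) := rowsub f 1%:M.
pose i := S *m (1%:M - d *m E); pose p := (1%:M - E *m d) *m S^T.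
exists (i *m d *m p), (i *m a); split.
- rewrite -[X in (_ < X)%N]card_ord; apply/proper_card/properP.
  split; first exact/subsetP.
  by exists r; rewrite ?inE ?eqxx ?andbF.
- have SE : S *m E = 0.
    rewrite -rowsubE; apply/matrixP=> s t; rewrite !mxE.
    by rewrite (negPf (fc s)) mulr0.
  have ES : E *m S^T = 0.
    apply/matrixP=> s t; rewrite !mxE big1 // => j _; rewrite !mxE.
    have [->|_] := eqVneq j r; last by rewrite andbF mulr0 mul0r.
    by rewrite (negPf (fr t)) mulr0.
  have SS : S *m S^T = 1%:M.
    rewrite -rowsubE; apply/matrixP=> s t; rewrite !mxE eq_sym.
    by rewrite (inj_eq enum_val_inj).
  have STS : S^T *m S = 1%:M - delta_mx c c - delta_mx r r.
    apply/matrixP=> s t; rewrite [LHS]mxE.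
    have [->|sr] := eqVneq s r.
      rewrite big1 => [|j _]; last by rewrite !mxE (negPf (fr j)) mul0r.
      by rewrite !mxE eqxx (negPf rc) /= subr0 eq_sym subrr.
    have [->|sc] := eqVneq s c.
      rewrite big1 => [|j _]; last by rewrite !mxE (negPf (fc j)) mul0r.
      by rewrite !mxE eqxx [c == r]eq_sym (negPf rc) /= subr0 eq_sym subrr.
    have [j0 fj0] := onto s sr sc.
    rewrite (bigD1 j0) //= big1 => [|j nj]; last first.
      by rewrite !mxE -fj0 (inj_eq enum_val_inj) (negPf nj) mul0r.
    by rewrite !mxE fj0 eqxx mul1r addr0 (negPf sr) (negPf sc) !subr0.
  have Ecc : (1%:M - E *m d) *m delta_mx c c = 0.
    by rewrite mulmxBl mul1mx /E -!scalemxAl dl scalerA vu scale1r subrr.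
  have Err : delta_mx r r *m (1%:M - d *m E) = 0.
    by rewrite mulmxBr mulmx1 /E -!scalemxAr mulmxA dl scalerA vu scale1r subrr.
  have piE : p *m i = 1%:M - d *m E - E *m d.
    rewrite /p /i mulmxA -[_ *m S^T *m S]mulmxA STS.
    rewrite [_ *m (_ - _ - _)]mulmxBr [_ *m (_ - delta_mx c c)]mulmxBr Ecc subr0 mulmx1.
    rewrite mulmxBl -[_ *m delta_mx r r *m _]mulmxA Err mulmx0 subr0.
    rewrite mulmxBl mul1mx mulmxBr mulmx1 -mulmxA [d *m (d *m E)]mulmxA (gdd G).
    by rewrite mul0mx mulmx0 subr0.
  have gE : graded (fun s => (h s).+1) e h e E.
    apply/gradedP=> s t; rewrite !mxE.
    case: (s =P c) => [->|_]; last by rewrite mulr0 eqxx.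
    case: (t =P r) => [->|_]; last by rewrite mulr0 eqxx.
    rewrite mulr1 hrc erc subnn; split=> //; apply/dhomogP=> m.
    by rewrite msuppC; case: ifP => // _; rewrite inE => /eqP->; apply: mf0.
  have gdE : graded h e h e (d *m E) := gradedM (gd G) gE.
  have gEd : graded h e h e (E *m d).
    by have := gradedM gE (gd G); rewrite /graded gpartS.
  have Ea : E *m a = 0.
    rewrite /E -scalemxAl; apply/matrixP=> s t; rewrite !mxE big1 ?mulr0 // => j _.
    rewrite !mxE; have [->|_] := eqVneq j r; last by rewrite andbF mul0r.
    have /gradedP ga' := ga G.
    have [->|/ga'[]] := eqVneq (a r t) 0; rewrite ?mulr0 //.
    by rewrite hrc.
  apply: (gres_retract G).
  - exact: gradedM (graded_select h e f) (gradedB (graded1 h e) gdE).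
  - exact: gradedM (gradedB (graded1 h e) gEd) (graded_selectT h e f).
  - have PP : (1%:M - d *m E) *m (1%:M - E *m d) = 1%:M - E *m d - d *m E.
      rewrite mulmxBl mul1mx mulmxBr mulmx1 -mulmxA [E *m (E *m d)]mulmxA EE.
      by rewrite mul0mx mulmx0 subr0.
    rewrite /i /p mulmxA -[S *m _ *m _]mulmxA PP.
    rewrite 2!mulmxBr mulmx1 !mulmxA SE mul0mx subr0 mulmxBl SS.
    by rewrite -[_ *m d *m E *m _]mulmxA ES mulmx0 subr0.
  - have Edd : E *m d *m d = 0 by rewrite -mulmxA (gdd G) mulmx0.
    have ddE : d *m (d *m E) = 0 by rewrite mulmxA (gdd G) mul0mx.
    rewrite piE !mulmxBl !mulmxBr mul1mx mulmx1 Edd ddE !subr0.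
    exact: (congr1 (fun A => d - A) (esym (mulmxA d E d))).
  rewrite piE !mulmxBl mul1mx -!mulmxA Ea mulmx0 subr0 addrAC subrr sub0r.
  exact/inMN/inMM/(gda G)/(gup G).
exact: onto.
Qed.

Definition minimal_mx p q (A : 'M[R]_(p, q)) := forall s t, (A s t)@_0%MM = 0.

Lemma has_gres_min U L rho top : has_gres k U L rho top ->
  exists N (h e : 'I_N -> nat) (d : 'M[R]_N) a,
  [/\ gres U h e d a, forall s, (h s <= L)%N /\ (e s <= rho + h s)%N,
      top -> exists s, h s = L /\ e s = (rho + L)%N & minimal_mx d].
Proof.
case=> N; have [M] := ubnP N; elim: M N => // M IHM N ltNM.
move=> [h [e [d [a [G hb ht]]]]].
have [min_d|/existsNP[r /existsNP[c /eqP nz]]] := pselect (minimal_mx d).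
  by exists N, h, e, d, a.
have [hrc [erc [N' [f [d' [a' [lt_N' G' onto]]]]]]] := gres_cancel G nz.
apply: (IHM N'); first by lia.
exists (h \o f), (e \o f), d', a'; split=> // [s|/ht[s [hs es]]]; first exact: hb.
(* A cancelled pair shares its internal degree: in homological degree L - 1 the partner of [s] would
   exceed the bound, and degree L + 1 is empty. *)
have [||t ft] := onto s; last by exists t; rewrite /= ft.
  by apply/eqP=> sr; have := hb c; rewrite -sr in hrc erc; lia.
by apply/eqP=> sc; have := hb r; rewrite -sc in hrc erc; lia.
Qed.

End Minimal.

(** * Comparison of resolutions *)

Section LinearMaps.

Variables (R : nzRingType) (A B : lmodType R).

Definition mklin (f : A -> B) (lin_f : linear f) : {linear A -> B} :=
  HB.pack f (GRing.isLinear.Build R A B *:%R f lin_f).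

End LinearMaps.

Section Pullback.

Variables (R : nzRingType) (P A B : lmodType R).
Variables (f : {linear P -> B}) (g : {linear A -> B}).

Definition pullback : {pred P * A} := fun u => f u.1 == g u.2.

Lemma pullback_submod_closed : submod_closed pullback.
Proof.
split=> [|a u v /eqP uE /eqP vE]; first by rewrite unfold_in /= !raddf0.
by rewrite unfold_in /= !linearP uE vE.
Qed.

HB.instance Definition _ :=
  GRing.isSubmodClosed.Build R (P * A)%type pullback pullback_submod_closed.

Record pullback_type := Pullback { pb_val :> P * A; _ : pb_val \in pullback }.
HB.instance Definition _ := [isSub for pb_val].
HB.instance Definition _ := [Choice of pullback_type by <:].
HB.instance Definition _ := [SubChoice_isSubLmodule of pullback_type by <:].

(** [projective] lifts along surjections, while here the image of [f] merely lies in that of [g].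
    The pullback surjects onto P; a section of it followed by the projection to A is the lift. *)
Lemma projective_lift : projective P -> (forall x, exists y, g y = f x) ->
  exists h : {linear P -> A}, forall x, g (h x) = f x.
Proof.
move=> projP gf.
have lin1 : linear (fun u : pullback_type => (val u).1).
  by move=> a u v; rewrite linearP.
have [|h hE] := projP pullback_type P (mklin lin1) idfun.
  move=> x; have [y gy] := gf x.
  have pb : (x, y) \in pullback by rewrite unfold_in /= gy.
  by exists (Pullback pb).
have lin2 : linear (fun x => (val (h x)).2) by move=> a u v; rewrite !linearP.
exists (mklin lin2) => x /=; have := valP (h x); rewrite unfold_in => /eqP <-.
by have /= -> := hE x.
Qed.

End Pullback.

Lemma projective_free (R : nzRingType) m : projective ('rV[R]_m).
Proof.
move=> M N g f gsurj.
have [y hy] := fin_all_exists (fun i : 'I_m => gsurj (f (delta_mx 0 i))).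
have lin : linear (fun x : 'rV[R]_m => \sum_i x 0 i *: y i).
  move=> a u v; rewrite scaler_sumr -big_split /=; apply: eq_bigr => i _.
  by rewrite !mxE scalerDl scalerA.
exists (mklin lin) => x /=; rewrite linear_sum {2}[x]row_sum_delta linear_sum.
by apply: eq_bigr => i _; rewrite !linearZ /= hy.
Qed.

Section Comparison.

Variable R : nzRingType.

(** Common form of two arguments: with [psi] an augmentation in degree 0 and zero above, it gives a
    comparison map; with [psi] a chain map that induces zero, a null-homotopy. *)
Lemma comparison_lift (F X : nat -> lmodType R)
    (dF : forall i, {linear F i.+1 -> F i}) (dX : forall i, {linear X i.+1 -> X i})
    (psi : forall i, {linear F i -> X i}) :
  (forall i, projective (F i)) ->
  (forall i x, dF i (dF i.+1 x) = 0) ->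
  (forall i x, dX i x = 0 -> exists y, dX i.+1 y = x) ->
  (forall x, exists y, dX 0%N y = psi 0%N x) ->
  (forall i x, dX i (psi i.+1 x) = psi i (dF i x)) ->
  exists th : forall i, {linear F i -> X i.+1},
    (forall x, dX 0%N (th 0%N x) = psi 0%N x) /\
    forall i x, dX i.+1 (th i.+1 x) = psi i.+1 x - th i (dF i x).
Proof.
move=> projF ddF exX psi0 psiS.
(* The invariant, carried along with the map, puts the next right-hand side in the kernel of
   [dX]. *)
pose state i :=
  {t : {linear F i -> X i.+1} | forall x, dX i (t (dF i x)) = psi i (dF i x)}.
have step i (s : state i) : {s' : state i.+1 |
    forall x, dX i.+1 (sval s' x) = psi i.+1 x - sval s (dF i x)}.
  apply: cid; case: s => t ht /=; have lin : linear (fun x => psi i.+1 x - t (dF i x)).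
    by move=> a u v; rewrite !linearP /= scalerBr scalerN addrACA.
  have [|t' ht'] := projective_lift (f := mklin lin) (g := dX i.+1) (projF i.+1).
    by move=> x; apply: exX => /=; rewrite linearB /= psiS ht subrr.
  have inv x : dX i.+1 (t' (dF i.+1 x)) = psi i.+1 (dF i.+1 x).
    by rewrite ht' /= ddF linear0 subr0.
  by exists (exist _ t' inv).
have [t0 ht0] := cid (projective_lift (projF 0%N) psi0).
pose s0 : state 0%N := exist _ t0 (fun x => ht0 (dF 0%N x)).
pose s := nat_rect state s0 (fun i si => sval (step i si)).
exists (fun i => sval (s i)); split=> // i; exact: svalP (step i (s i)).
Qed.

Variables (M : lmodType R) (F G : nat -> lmodType R).
Variables (dF : forall i, {linear F i.+1 -> F i}) (epsF : {linear F 0%N -> M}).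
Variables (dG : forall i, {linear G i.+1 -> G i}) (epsG : {linear G 0%N -> M}).
Hypotheses (projF : forall i, projective (F i)) (resF : resolution dF epsF)
  (resG : resolution dG epsG).

Lemma resolution_dd i x : dF i (dF i.+1 x) = 0.
Proof. by have [_ _ ex] := resF; apply/ex; exists x. Qed.

Lemma comparison_map : exists al : forall i, {linear F i -> G i},
  (forall x, epsG (al 0%N x) = epsF x) /\
  forall i x, dG i (al i.+1 x) = al i (dF i x).
Proof.
have [epsGs exG0 exG] := resG; have [_ exF0 exF] := resF.
(* The augmented complex of G, shifted so that M has index 0. *)
pose X i : lmodType R := if i is j.+1 then G j else M.
pose dX i : {linear X i.+1 -> X i} :=
  match i return {linear X i.+1 -> X i} with 0%N => epsG | j.+1 => dG j end.
pose psi i : {linear F i -> X i} :=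
  match i return {linear F i -> X i} with 0%N => epsF | j.+1 => \0 end.
(* Negating [dF] turns the homotopy relation into commutation with the differentials. *)
have linN i : linear (fun x => - dF i x).
  by move=> a u v; rewrite linearP opprD scalerN.
have [||||th [th0 thS]] := @comparison_lift F X (fun i => mklin (linN i)) dX psi projF.
- by move=> i x /=; rewrite linearN /= resolution_dd !oppr0.
- by case=> [|i] x /=; [move/exG0 | move/exG].
- by move=> x; apply: epsGs.
- case=> [|i] x /=; last exact: linear0.
  rewrite linear0 linearN /=; apply/esym/eqP; rewrite oppr_eq0.
  by apply/eqP/exF0; exists x.
exists th; split=> // i x; rewrite (thS i x) /= linearN opprK /=.
by rewrite add0r.
Qed.

Lemma comparison_homotopy (psi : forall i, {linear F i -> G i}) :
  (forall x, epsG (psi 0%N x) = 0) ->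
  (forall i x, dG i (psi i.+1 x) = psi i (dF i x)) ->
  exists th : forall i, {linear F i -> G i.+1},
    (forall x, dG 0%N (th 0%N x) = psi 0%N x) /\
    forall i x, dG i.+1 (th i.+1 x) = psi i.+1 x - th i (dF i x).
Proof.
move=> psi0 psiS; have [_ exG0 exG] := resG; apply: comparison_lift => //.
- exact: resolution_dd.
- by move=> i x /exG.
by move=> x; apply/exG0.
Qed.

End Comparison.

(** * Invariants read off a minimal resolution *)

Section MinimalResolutions.

Variables (n : nat) (k : fieldType) (J : finType) (P : pred J).
Variable g : J -> {mpoly k[n]}.
Notation R := {mpoly k[n]}.
Notation M := (quotmod P g).

Lemma mcoeff0M (x y : R) : (x * y)@_0%MM = x@_0%MM * y@_0%MM.
Proof. exact: (rmorphM (mcoeff 0%MM)). Qed.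

Lemma minimal_mxM p q r (A : 'M[R]_(p, q)) (B : 'M[R]_(q, r)) :
  minimal_mx B -> minimal_mx (A *m B).
Proof.
move=> minB i j; rewrite mxE (raddf_sum (mcoeff 0%MM)) big1 // => l _.
by rewrite /= mcoeff0M minB mulr0.
Qed.

Lemma minimal_mxMl p q r (A : 'M[R]_(p, q)) (B : 'M[R]_(q, r)) :
  minimal_mx A -> minimal_mx (A *m B).
Proof.
move=> minA i j; rewrite mxE (raddf_sum (mcoeff 0%MM)) big1 // => l _.
by rewrite /= mcoeff0M minA mul0r.
Qed.

Lemma minimal_mx_linear p q (h : {linear 'rV[R]_p -> 'rV[R]_q}) (u : 'rV[R]_p) :
  minimal_mx u -> minimal_mx (h u).
Proof.
move=> minu i j; rewrite [u]row_sum_delta linear_sum summxE.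
rewrite (raddf_sum (mcoeff 0%MM)) big1 // => l _.
by rewrite linearZ mxE /= mcoeff0M minu mul0r.
Qed.

(* If a minimal free resolution factors up to homotopy through a complex which
   vanishes in degree i.+1, its identity in degree i.+1 is zero modulo the
   maximal ideal. *)
Lemma minimal_length b (phi : forall i, 'M[R]_(b i.+1, b i))
    (eps : {linear 'rV[R]_(b 0%N) -> M}) l i :
  resolution (F := fun i => 'rV[R]_(b i)) (fun i => mulmxr (phi i)) eps ->
  (forall i, minimal_mx (phi i)) ->
  has_projective_resolution M l -> (l <= i)%N -> b i.+1 = 0%N.
Proof.
move=> resG minG [F [dF [epsF [resF projF F0]]]] le_li.
have projG i' : projective ('rV[R]_(b i')) by exact: projective_free.
have [al [al0 alS]] := comparison_map projG resG resF.
have [be [be0 beS]] := comparison_map projF resF resG.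
have lin j : linear (fun x : 'rV[R]_(b j) => be j (al j x) - x).
  by move=> a u v; rewrite !linearP /= scalerBr scalerN addrACA.
pose psi j := mklin (lin j).
have [||th [_ thS]] := comparison_homotopy projG resG resG (psi := psi).
- by move=> x /=; rewrite linearB /= be0 al0 subrr.
- by move=> j x; have := beS j (al j.+1 x); rewrite alS /= mulmxBl => ->.
apply/eqP; rewrite -leqn0 leqNgt; apply/negP=> b_gt0.
pose c := Ordinal b_gt0; have /= E := thS i (delta_mx 0 c).
rewrite [al _ _]F0 ?ltnS // linear0 sub0r in E.
have min1 : minimal_mx (delta_mx 0 c : 'rV[R]_(b i.+1)).
  have -> : delta_mx 0 c = - (th i.+1 (delta_mx 0 c) *m phi i.+1) -
                           th i (delta_mx 0 c *m phi i) :> 'rV[R]_(b i.+1).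
    by rewrite E opprD !opprK addrK.
  move=> s t; rewrite !mxE mcoeffB mcoeffN.
  have := minimal_mxM (th i.+1 (delta_mx 0 c)) (minG i.+1) s t; rewrite mxE => ->.
  by rewrite (minimal_mx_linear _ (minimal_mxM _ (minG i))) !oppr0 ?addr0.
by have /eqP := min1 0 c; rewrite mxE !eqxx mcoeff1 eqxx oner_eq0.
Qed.

Local Notation z := (fun=> 0%N).

Lemma pimod0 : pimod P g 0 = 0.
Proof. by apply: (addrI (pimod P g 0)); rewrite -pimodD !addr0. Qed.

Lemma eps_col m (e : 'I_m -> nat) (eps : {linear 'rV[R]_m -> M}) :
  (forall c, exists2 a : R, a \is (e c).-homog & eps (delta_mx 0 c) = pimod P g a) ->
  exists2 a : 'cV[R]_m, graded z e z z a &
    forall x, eps x = pimod P g ((x *m a) 0 0).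
Proof.
move=> h; have [a homa aE] := fin_all_exists2 h.
exists (\col_c a c).
  by apply/gradedP=> s t; rewrite !mxE subn0.
move=> x; rewrite {1}[x]row_sum_delta linear_sum mxE.
rewrite (big_morph (pimod P g) (pimodD P g) pimod0).
by apply: eq_bigr => c _; rewrite linearZ /= aE mxE; apply: quotmod_scaleE.
Qed.

Lemma comparison_graded U b e (phi : forall i, 'M[R]_(b i.+1, b i)) eps
    b' e' (phi' : forall i, 'M[R]_(b' i.+1, b' i)) eps'
    (a : 'cV_(b 0%N)) (a' : 'cV_(b' 0%N)) :
  (forall f, f \in ideal P g <-> f \in monideal U) ->
  resolution (M := M) (F := fun i => 'rV[R]_(b i)) (fun i => mulmxr (phi i)) eps ->
  resolution (M := M) (F := fun i => 'rV[R]_(b' i)) (fun i => mulmxr (phi' i)) eps' ->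
  (forall i, graded z (e i.+1) z (e i) (phi i)) ->
  (forall i, graded z (e' i.+1) z (e' i) (phi' i)) ->
  graded z (e 0%N) z z a -> (forall x, eps x = pimod P g ((x *m a) 0 0)) ->
  graded z (e' 0%N) z z a' -> (forall x, eps' x = pimod P g ((x *m a') 0 0)) ->
  exists A : forall i, 'M[R]_(b i, b' i),
    [/\ forall i, graded z (e i) z (e' i) (A i),
        forall i, A i.+1 *m phi' i = phi i *m A i & inM U (A 0%N *m a' - a)].
Proof.
move=> hI resF resG gphi gphi' ga epsE ga' epsE'.
have projF i : projective ('rV[R]_(b i)) by exact: projective_free.
have [al [al0 alS]] := comparison_map projF resF resG.
exists (fun i => gpart z (e i) z (e' i) (lin1_mx (al i))); split.
- by move=> i; apply: gpart_graded.
- move=> i; rewrite -(gpartMr _ _ _ (gphi' i)) -(gpartMl _ _ _ (gphi i)).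
  congr (gpart _ _ _ _ _); apply/row_matrixP=> s; rewrite !rowE !mulmxA !mul_rV_lin1.
  exact: alS.
rewrite -(gpartMr _ _ _ ga') -ga -raddfB; apply: inM_gpart => s t.
rewrite !ord1; apply/hI; have := al0 (delta_mx 0 s).
by rewrite epsE epsE' -mul_rV_lin1 -mulmxA -!rowE => /pimod_eq; rewrite !mxE.
Qed.

(** A B - 1 is null-homotopic, so by minimality its entries in row c lie in the maximal ideal. Hence
    the diagonal entry of A B at c has constant term 1, some entry of A in row c has a nonzero
    constant term, and such a graded entry joins equal degrees. Regularity only asks which degrees
    occur. *)
Lemma minimal_degrees U b e phi eps b' e' phi' eps' i (c : 'I_(b i)) :
  (forall f, f \in ideal P g <-> f \in monideal U) ->
  up_closed U ->
  @minimal_graded_resolution k n J P g b e phi eps ->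
  @minimal_graded_resolution k n J P g b' e' phi' eps' ->
  exists t, e' i t = e i c.
Proof.
move=> hI upU [resF epsF gF minF] [resG epsG gG _].
have [a ga epsE] := eps_col epsF; have [a' ga' epsE'] := eps_col epsG.
have gphi j : graded z (e j.+1) z (e j) (phi j).
  by apply/gradedP=> s t nz; have := gF j s t; case: ifP => // _; rewrite (negPf nz).
have gphi' j : graded z (e' j.+1) z (e' j) (phi' j).
  by apply/gradedP=> s t nz; have := gG j s t; case: ifP => // _; rewrite (negPf nz).
have [A [gA AS A0]] := comparison_graded hI resF resG gphi gphi' ga epsE ga' epsE'.
have [B [gB BS B0]] := comparison_graded hI resG resF gphi' gphi ga' epsE' ga epsE.
pose psi j := mulmxr (A j *m B j - 1%:M) : {linear 'rV[R]_(b j) -> 'rV[R]_(b j)}.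
have projF j : projective ('rV[R]_(b j)) by exact: projective_free.
have [||th [th0 thS]] := comparison_homotopy projF resF resF (psi := psi).
- move=> x; rewrite epsE /= -mulmxA.
  rewrite -pimod0; apply/pimod_eq/hI; rewrite subr0.
  suff : inM U (x *m ((A 0%N *m B 0%N - 1%:M) *m a)) by exact.
  apply: inMM => //.
  rewrite mulmxBl mul1mx -mulmxA; apply: inM_trans A0.
  by rewrite -mulmxBr; apply: inMM.
- move=> j x /=; rewrite -!mulmxA mulmxBr mulmxBl mulmx1 mul1mx -mulmxA BS.
  by rewrite !mulmxA AS.
have minpsi : minimal_mx (psi i (delta_mx 0 c)).
  case: i c => [|i] c; first by rewrite -th0; apply: minimal_mxM.
  have /= := thS i (delta_mx 0 c); move/eqP; rewrite eq_sym subr_eq => /eqP->.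
  move=> s t; rewrite mxE mcoeffD (minimal_mxM _ (minF _)) add0r.
  exact/minimal_mx_linear/minimal_mxM.
have := minpsi 0 c; rewrite /= -rowE !mxE eqxx mcoeffB mcoeff1 eqxx => /eqP.
rewrite subr_eq0 (raddf_sum (mcoeff 0%MM)) /= => E.
have [t nz] : exists t, (A i c t)@_0%MM != 0.
  apply/existsP; apply: contraLR E => /existsPn A0'; rewrite big1 => [|t _].
    by rewrite eq_sym oner_eq0.
  by rewrite mcoeff0M; have /negPn/eqP-> := A0' t; rewrite mul0r.
exists t; have nzA : A i c t != 0 by apply: contraNneq nz => ->; rewrite mcoeff0.
have /gradedP/(_ _ _ nzA)[_ le_e hom] := gA i.
have := dhomogP _ _ _ hom 0%MM; rewrite mcoeff_msupp nz mf0 => /(_ isT); lia.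
Qed.

End MinimalResolutions.

(** * Splitting a graded resolution by homological degree *)

Section LevelwiseResolution.

Variables (n : nat) (k : fieldType) (J : finType) (P : pred J).
Variables (g : J -> {mpoly k[n]}) (U : pred 'X_{1..n}).
Notation R := {mpoly k[n]}.
Notation M := (quotmod P g).
Hypothesis hI : forall f, f \in ideal P g <-> f \in monideal U.

Variables (N : nat) (h e : 'I_N -> nat) (d : 'M[R]_N) (a : 'cV[R]_N).
Hypotheses (G : gres U h e d a) (min_d : minimal_mx d).

Definition level_size i := #|[set s | h s == i]|.
Definition level_val i : 'I_(level_size i) -> 'I_N := enum_val.

Notation S i := (rowsub (@level_val i) 1%:M : 'M[R]_(level_size i, N)).
(** On row vectors, [S i] embeds the basis vectors of degree i into the whole module and its
    transpose restricts to them. *)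
Definition level_diff i := S i.+1 *m d *m (S i)^T.

Lemma level_valP i c : h (@level_val i c) = i.
Proof. by have := enum_valP c; rewrite inE => /eqP. Qed.

Lemma level_val_onto s : exists c, @level_val (h s) c = s.
Proof.
have sA : s \in [set s' | h s' == h s] by rewrite inE.
by exists (enum_rank_in sA s); apply: enum_rankK_in.
Qed.

Lemma levelK i : S i *m (S i)^T = 1%:M.
Proof.
by rewrite -rowsubE; apply/matrixP=> s t; rewrite !mxE eq_sym (inj_eq enum_val_inj).
Qed.

Lemma level_proj i s t : ((S i)^T *m S i) s t = ((s == t) && (h s == i))%:R.
Proof.
rewrite mxE; have [hs|hs] := eqVneq (h s) i; last first.
  rewrite andbF big1 // => c _; rewrite !mxE; have [cs|_] := eqVneq _ s.
    by rewrite -cs level_valP eqxx in hs.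
  by rewrite mul0r.
rewrite -hs; have [c cs] := level_val_onto s.
rewrite (bigD1 c) //= big1 => [|c' nc]; last first.
  have /negPf ne : level_val c' != s by rewrite -[X in _ != X]cs (inj_eq enum_val_inj).
  by rewrite !mxE ne mul0r.
by rewrite !mxE cs eqxx mul1r addr0 andbT.
Qed.

Lemma mul_level_proj i p (A : 'M[R]_(p, N)) :
  (forall s t, A s t != 0 -> h t = i) -> A *m (S i)^T *m S i = A.
Proof.
move=> hA; rewrite -mulmxA; apply/matrixP=> s t.
rewrite mxE (bigD1 t) //= big1 => [|j jt].
  rewrite level_proj eqxx addr0; have [->|/hA->] := eqVneq (A s t) 0.
    by rewrite mul0r.
  by rewrite eqxx mulr1.
by rewrite level_proj (negPf jt) mulr0.
Qed.

Lemma level_proj_mul i q (A : 'M[R]_(N, q)) :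
  (forall s t, A s t != 0 -> h s = i) -> (S i)^T *m (S i *m A) = A.
Proof.
move=> hA; rewrite mulmxA; apply/matrixP=> s t.
rewrite mxE (bigD1 s) //= big1 => [|j js].
  rewrite level_proj eqxx addr0; have [->|/hA->] := eqVneq (A s t) 0.
    by rewrite mulr0.
  by rewrite eqxx mul1r.
by rewrite level_proj eq_sym (negPf js) mul0r.
Qed.

Lemma level_graded i : graded (h \o @level_val i) (e \o @level_val i) h e (S i).
Proof. exact: graded_select. Qed.

Lemma level_diffl i : level_diff i *m S i = S i.+1 *m d.
Proof.
apply: mul_level_proj => s t.
have /gradedP gSd := gradedM (level_graded i.+1) (gd G).
by case/gSd=> /= E _ _; move: E; rewrite level_valP => -[].
Qed.

Lemma level_diffr i : (S i.+1)^T *m level_diff i = d *m (S i)^T.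
Proof.
rewrite /level_diff -mulmxA; apply: level_proj_mul => s t.
have /gradedP gdS := gradedM (gd G) (gradedS (graded_selectT h e (@level_val i))).
by case/gdS=> /= -> _ _; rewrite level_valP.
Qed.

Lemma level_aug : (S 0)^T *m (S 0 *m a) = a.
Proof. by apply: level_proj_mul => s t; have /gradedP ga' := ga G; case/ga'. Qed.

Lemma level_aug_S i : S i.+1 *m a = 0.
Proof.
have /gradedP gSa := gradedM (level_graded i.+1) (ga G).
apply/matrixP=> s t; rewrite [RHS]mxE; apply/eqP; apply: contraT => /gSa[/= E _ _].
by rewrite level_valP in E.
Qed.

Lemma level_diff_0 : S 0 *m d = 0.
Proof.
have /gradedP gSd := gradedM (level_graded 0) (gd G).
apply/matrixP=> s t; rewrite [RHS]mxE; apply/eqP; apply: contraT => /gSd[/= E _ _].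
by rewrite level_valP in E.
Qed.

Lemma level_eps_linear : linear (fun x : 'rV[R]_(level_size 0) =>
  pimod P g ((x *m (S 0 *m a)) 0 0) : M).
Proof.
move=> c u v; rewrite mulmxDl mxE -scalemxAl mxE pimodD.
by congr (_ + _); apply/esym/quotmod_scaleE.
Qed.

Definition level_eps := mklin level_eps_linear.

Lemma pimod_eq0 f : pimod P g f = 0 <-> f \in monideal U.
Proof. by rewrite -pimod0 pimod_eq subr0. Qed.

Lemma level_resolution :
  resolution (F := fun i => 'rV[R]_(level_size i))
    (fun i => mulmxr (level_diff i)) level_eps.
Proof.
split=> [y|x|i x] /=.
- have [f <-] := pimod_surj y; have [y0 hy] := gunit G.
  exists (f *: (y0 *m (S 0)^T)); apply/pimod_eq/hI.
  rewrite -scalemxAl -mulmxA level_aug mxE -[X in _ - X]mulr1 -mulrBr.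
  by apply: monidealMl (gup G) _; have := hy 0 0; rewrite !mxE.
- split=> [/pimod_eq0 xa|[y <-]].
    have [||y yE] := gexact G (x := x *m S 0).
    + by rewrite -mulmxA level_diff_0 mulmx0.
    + by move=> s t; rewrite !ord1 -mulmxA.
    exists (y *m (S 1)^T); rewrite -mulmxA level_diffr mulmxA -yE -mulmxA levelK.
    by rewrite mulmx1.
  apply/pimod_eq0; suff : inM U (y *m level_diff 0 *m (S 0 *m a)) by exact.
  rewrite -mulmxA [level_diff 0 *m _]mulmxA level_diffl -[S 1 *m d *m a]mulmxA.
  by do 2![apply: inMM; first exact: gup G]; apply: gda G.
split=> [xd|[y <-]].
  have [||y yE] := gexact G (x := x *m S i.+1).
  - by rewrite -mulmxA -level_diffl mulmxA xd mul0mx.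
  - by rewrite -mulmxA level_aug_S mulmx0; apply: inM0.
  (* Only the component of [y] in degree i + 2 contributes to this boundary. *)
  exists (y *m (S i.+2)^T); rewrite -mulmxA level_diffr mulmxA -yE -mulmxA levelK.
  by rewrite mulmx1.
rewrite -[LHS]mulmx1 -levelK mulmxA -[_ *m S i]mulmxA level_diffl.
by rewrite mulmxA -[_ *m S i.+1]mulmxA level_diffl -!mulmxA [d *m (d *m _)]mulmxA (gdd G)
   mul0mx !mulmx0.
Qed.

Lemma level_minimal i : minimal_mx (level_diff i).
Proof. exact/minimal_mxMl/minimal_mxM. Qed.

Lemma level_minimal_graded :
  minimal_graded_resolution (fun i c => e (@level_val i c)) level_diff level_eps.
Proof.
split; [exact: level_resolution | | |exact: level_minimal].
- move=> c; exists ((S 0 *m a) c 0).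
    have [->|nz] := eqVneq ((S 0 *m a) c 0) 0; first exact: rpred0.
    have /gradedP/(_ _ _ nz)[_ _] := gradedM (level_graded 0) (ga G).
    by rewrite subn0.
  by rewrite /= -rowE mxE.
move=> i r c; have /gradedP gphi := gradedM (gradedM (level_graded i.+1) (gd G))
  (gradedS (graded_selectT h e (@level_val i))).
have [E|/gphi[_ le_e hom]] := eqVneq (level_diff i r c) 0.
  by rewrite E rpred0; case: ifP.
by rewrite le_e.
Qed.

End LevelwiseResolution.

Section PdimReg.

Variables (n : nat) (k : fieldType) (J : finType) (P : pred J).
Variables (g : J -> {mpoly k[n]}) (U : pred 'X_{1..n}).
Hypothesis hI : forall f, f \in ideal P g <-> f \in monideal U.

(** The extremal generator serves twice: in a minimal resolution it makes level L nonzero, which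
    forbids shorter projective resolutions, and it attains the maximal difference rho of degrees. *)
Lemma has_gres_pdim_reg L rho : has_gres k U L rho true ->
  is_pdim (quotmod P g) L /\ is_regularity P g rho.
Proof.
move/has_gres_min=> [N [h [e [d [a [G hb ht min_d]]]]]].
have [s [hs es]] := ht isT; have [c cs] := level_val_onto h s; rewrite hs in c cs.
have res := level_minimal_graded hI G min_d; have [resG _ _ _] := res.
split; split.
- exists (fun i => 'rV_(level_size h i)), (fun i => mulmxr (level_diff h d i)).
  exists (level_eps P g h a); split=> // [i|i lt_Li x]; first exact: projective_free.
  apply/matrixP=> s' [c' lt_c']; exfalso.
  by have [] := hb (level_val (Ordinal lt_c')); rewrite level_valP leqNgt lt_Li.
- move=> l; case: L {hb ht es} hs c cs => // L hs c cs resl; rewrite ltnNge.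
  apply/negP=> le_lL; have := minimal_length resG (level_minimal min_d) resl le_lL.
  by move=> b0; move: {cs} c; rewrite b0 => -[].
- exists L, (rho + L)%N; eexists; split; last by lia.
    exists (level_size h), (fun i c => e (@level_val _ h i c)), (level_diff h d).
    by exists (level_eps P g h a); split; [exact: res | reflexivity].
  rewrite -lt0n; apply/card_gt0P; exists c; rewrite inE cs es //.
move=> i j m [b [e' [phi [eps [res' <-]]]]]; rewrite -lt0n => /card_gt0P[c'].
rewrite inE => /eqP <-; have [t <-] := minimal_degrees c' hI (gup G) res' res.
by have [] := hb (level_val t); rewrite level_valP; lia.
Qed.

End PdimReg.

Section EdgeIdeal.

Variables (k : fieldType) (n : nat) (D : wograph n).

Lemma edge_gen_monomial p :
  edge_gen k D p = 'X_[(U_(p.1) + U_(p.2) *+ weight D p.2)%MM].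
Proof. by rewrite mpolyXD -mpolyXn. Qed.

Lemma ideal_gen (R : comNzRingType) (J : finType) (P : pred J) (g : J -> R) j :
  P j -> g j \in ideal P g.
Proof.
move=> Pj; apply/idealE; exists (fun i => (i == j)%:R).
rewrite (bigD1 j) //= eqxx mul1r big1 ?addr0 // => i /andP[_ /negPf->].
by rewrite mul0r.
Qed.

Lemma edge_idealE f :
  f \in ideal (is_edge D) (edge_gen k D) <-> f \in monideal (edge_mon D setT).
Proof.
split=> [/idealE[c ->]|/allP f_mon].
  apply: rpred_sum => -[i j] /= eij; rewrite edge_gen_monomial monidealMX.
  apply/monidealP=> m _; apply/edge_monP; exists i, j; rewrite !inE.
  split=> //; rewrite !mnmDE !mulmnE !mnm1E eqxx; first by rewrite addnCA.
  by rewrite mul1n addnA leq_addl.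
rewrite [f]mpolyE big_seq; apply: rpred_sum => m /f_mon/edge_monP[i [j [_ _ eij mi mj]]].
have ij : i != j by apply: contraTneq eij => ->; rewrite edge_irr.
have le_m : (U_(i) + U_(j) *+ weight D j <= m)%MM.
  apply/mnm_lepP=> l; rewrite mnmDE mulmnE !mnm1E.
  have [<-|_] := eqVneq i l; first by rewrite eq_sym (negPf ij).
  by have [<-|_] := eqVneq j l; rewrite ?mul1n.
rewrite -(submK le_m) mpolyXD -mul_mpolyC mulrA -(edge_gen_monomial (i, j)).
by apply: ideal_mull; apply: (@ideal_gen _ _ (is_edge D) _ (i, j)).
Qed.

End EdgeIdeal.

Theorem theorem4p9 (k : fieldType) (n : nat) (D : wograph n) (r : 'I_n)
    (hn : (2 <= n)%N) (hroot : rooted D r)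
    (hw : forall i : 'I_n, i != r -> (2 <= weight D i)%N) :
  is_pdim (edge_quot k D) n.-1 /\
  edge_regularity k D ((\sum_(i < n) weight D i)%N%:Z - n%:Z + 1).
Proof.
have [f f_lt] := rooted_rank hroot.
have r_source u : ~~ edge D u r by apply: (proj2 (rooted_sourceP hroot r)).
have in_edge v : v \in [set: 'I_n] -> v != r ->
    exists2 u, u \in [set: 'I_n] & edge D u v.
  by move=> _ /(rooted_in_edge hroot)[u euv]; exists u.
have := has_gres_rooted k f_lt r_source hw (in_setT r) in_edge.
(* [hn] turns the flag [1 < n] into [true], so the extremal generator exists. *)
rewrite cardsT card_ord hn => G.
have := has_gres_pdim_reg (@edge_idealE k n D) G; congr (_ /\ is_regularity _ _ _).
(* As the root has weight 1, subtracting n removes one from each other weight and cancels the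
   root. *)
have -> : (\sum_(i < n) weight D i =
    (\sum_(i in [set: 'I_n] :\ r) (weight D i).-1 + n.-1).+1)%N.
  rewrite (bigD1 r) //= (rooted_weight hroot) add1n; congr _.+1.
  have -> : n.-1 = (\sum_(i in [set: 'I_n] :\ r) 1)%N.
    by rewrite sum1_card -[X in X.-1]card_ord -cardsT (cardsD1 r) in_setT.
  rewrite -big_split /=; apply: eq_big => [i|i _]; first by rewrite !inE andbT.
  by rewrite addn1 prednK ?weight_gt0.
by move: (\sum_(i in _) _)%N => A; lia.
Qed.
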